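(* Let $n$ be a positive integer and let $\mu,\nu,\lambda$ be partitions of lengths $\ell(\mu),\ell(\nu),\ell(\lambda)\leq n$. Then $$n_{\mu,\nu}^{\lambda}=\#\,\mathcal{K}^{(n)}(\mu,\nu;\lambda),$$ where $\mathcal{K}^{(n)}(\mu,\nu;\lambda)$ is the set of composite $n$-hives with lower boundary $(\mu,\nu)$ and upper boundary $\lambda$.
   Context: Newell--Littlewood coefficients: $n_{\mu,\nu}^{\lambda}=\sum_{\alpha,\beta,\gamma} c_{\alpha,\beta}^{\mu}c_{\alpha,\gamma}^{\nu}c_{\beta,\gamma}^{\lambda}$, summed over all partitions $\alpha,\beta,\gamma$, where $c_{\mu,\nu}^{\lambda}$ is the Littlewood--Richardson coefficient (coefficient of the Schur function $s_\lambda$ in $s_\mu s_\nu$). Partitions of length $\le n$ are padded with zeros to $n$ parts. Composite $n$-hives. Let $T_n=\{(i,j)\in\mathbb{Z}^2: 0\leq i\leq 2n,\ i\leq j\leq \min(i+n,2n)\}$. These are the vertices of a trapezoidal piece of the triangular lattice (with $(1,0)$ pointing down-right, $(0,1)$ up-right and $(1,1)$ horizontally right), which is a union of three triangles of side $n$: $T_\mu=\{0\leq i\leq j\leq n\}$, $T_\nu=\{n\leq i\leq j\leq 2n\}$ and $T^\lambda=\{0\leq i\leq n\leq j\leq i+n\}$. An element of $\mathcal{K}^{(n)}(\mu,\nu;\lambda)$ is a labelling $(a_{i,j})_{(i,j)\in T_n}$ by integers with $a_{0,0}=0$ such that: (1) (lower and upper boundaries) for $1\leq i\leq n$: $a_{i,i}-a_{i-1,i-1}=\mu_i$,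 $a_{n+i,n+i}-a_{n+i-1,n+i-1}=\nu_i$, $a_{i,n+i}-a_{i-1,n+i-1}=\lambda_i$; (2) (rhombus constraints) for all $i,j$, each of the following inequalities holds whenever the four vertices appearing in it all lie in one and the same triangle $T_\mu$, $T_\nu$ or $T^\lambda$: $$a_{i-1,j-1}+a_{i,j-1}\geq a_{i,j}+a_{i-1,j-2},\qquad a_{i-1,j-1}+a_{i,j}\geq a_{i-1,j}+a_{i,j-1},\qquad a_{i,j-1}+a_{i,j}\geq a_{i-1,j-1}+a_{i+1,j};$$ (3) (matching of left and right boundaries) $a_{0,j}-a_{0,j-1}=a_{n+j,2n}-a_{n+j-1,2n}$ for $1\leq j\leq n$; (4) the sequences $\alpha_j=a_{0,j}-a_{0,j-1}$, $\beta_j=a_{j,n}-a_{j-1,n}$, $\gamma_j=a_{n,n+j}-a_{n,n+j-1}$ ($1\leq j\leq n$) are partitions; given (2), this amounts to $\alpha_n,\beta_n,\gamma_n\geq0$. *)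

(* Defs.v *)
From HB Require Import structures.
From mathcomp Require Import all_boot all_order all_algebra.
From mathcomp Require Import finmap mpoly.
From mathcomp.classical Require Import boolp classical_sets cardinality fsbigop.

Set Implicit Arguments.
Unset Strict Implicit.
Unset Printing Implicit Defensive.

Import Order.TTheory GRing.Theory Num.Theory.
Local Open Scope ring_scope.

(* A partition is the list of its nonzero parts, in weakly decreasing order;
   hence its length is [size la], and [part la i] is its i-th part
   ([1 <= i]), with value 0 beyond the length. *)
Definition is_partition (s : seq nat) : bool := sorted geq s && (0%N \notin s).

Record intpart : Type :=
  IntPart { parts :> seq nat; partsP : is_partition parts }.

HB.instance Definition _ := [isSub for parts].
HB.instance Definition _ := [Choice of intpart by <:].

Definition part (la : intpart) (i : nat) : nat := nth 0%N la i.-1.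

(* Cells of the Young diagram, with 0-based (row, column) coordinates; the
   bound [head 0 la] on the column is the largest part. *)
Definition cell (la : intpart) : finType :=
  {c : 'I_(size la) * 'I_(head 0%N la) | (c.2 < nth 0 la c.1)%N}.

Definition row_of (la : intpart) (c : cell la) : nat := (val c).1.
Definition col_of (la : intpart) (c : cell la) : nat := (val c).2.

Definition is_ssyt (N : nat) (la : intpart) (T : {ffun cell la -> 'I_N}) :
    bool :=
  [forall c, forall d,
     ((row_of c == row_of d) && (col_of c < col_of d)%N ==> (T c <= T d)%N)
     && ((col_of c == col_of d) && (row_of c < row_of d)%N ==> (T c < T d)%N)].

Definition schur (N : nat) (la : intpart) : {mpoly int[N]} :=
  \sum_(T : {ffun cell la -> 'I_N} | is_ssyt T) \prod_c 'X_(T c).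

(* A symmetric function is represented by the family of its restrictions to
   the first N variables, for all N. [schur_expansion f c] says that
   f = \sum_la c(la) s_la, with only finitely many nonzero c(la). *)
Definition schur_expansion (f : forall N, {mpoly int[N]})
    (c : intpart -> int) : Prop :=
  finite_set [set la | c la != 0]%classic /\
  forall N, f N = \sum_(la \in [set: intpart]%classic) c la *: schur N la.

(* The coefficient of s_la in f; by convention 0 when f has no expansion. *)
Definition schur_coef (f : forall N, {mpoly int[N]}) (la : intpart) : int :=
  xget 0 [set k | exists2 c, schur_expansion f c & k = c la]%classic.

Definition lr_coef (mu nu la : intpart) : int :=
  schur_coef (fun N => schur N mu * schur N nu) la.

(* Finitely supported sum over all triples of partitions. *)
Definition nl_coef (mu nu la : intpart) : int :=
  \sum_(p \in [set: intpart * intpart * intpart]%classic)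
    let: (al, be, ga) := p in
    lr_coef al be mu * lr_coef al ga nu * lr_coef be ga la.

Definition in_trapezoid (n i j : nat) : bool :=
  [&& (i <= 2 * n)%N, (i <= j)%N & (j <= minn (i + n) (2 * n))%N].

Definition vertex (n : nat) : finType :=
  {v : 'I_(2 * n).+1 * 'I_(2 * n).+1 | in_trapezoid n v.1 v.2}.

Definition labelling (n : nat) : Type := {ffun vertex n -> int}.
HB.instance Definition _ n := Choice.on (labelling n).

(* The label a_{i,j}; the default value 0 outside of T_n is never used in
   [composite_hive], all of whose conditions only involve vertices of T_n. *)
Definition label (n : nat) (a : labelling n) (i j : nat) : int :=
  if [pick v : vertex n | ((val v).1 == i :> nat) && ((val v).2 == j :> nat)]
    is Some v then a v else 0.

Definition in_tri_mu (n : nat) (v : nat * nat) : bool :=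
  (v.1 <= v.2 <= n)%N.
Definition in_tri_nu (n : nat) (v : nat * nat) : bool :=
  [&& (n <= v.1)%N, (v.1 <= v.2)%N & (v.2 <= 2 * n)%N].
Definition in_tri_la (n : nat) (v : nat * nat) : bool :=
  [&& (v.1 <= n)%N, (n <= v.2)%N & (v.2 <= v.1 + n)%N].

Definition same_triangle (n : nat) (vs : seq (nat * nat)) : bool :=
  [|| all (in_tri_mu n) vs, all (in_tri_nu n) vs | all (in_tri_la n) vs].

(* The inequality  a_p + a_q >= a_r + a_s,  imposed only on rhombi contained
   in one of the three triangles. *)
Definition rhombus (n : nat) (a : labelling n) (p q r s : nat * nat) : Prop :=
  same_triangle n [:: p; q; r; s] ->
  label a p.1 p.2 + label a q.1 q.2 >= label a r.1 r.2 + label a s.1 s.2.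

(* x_1, ..., x_n is weakly decreasing and nonnegative. *)
Definition partition_seq (n : nat) (x : nat -> int) : Prop :=
  (forall j, (1 <= j < n)%N -> x j.+1 <= x j) /\
  (forall j, (1 <= j <= n)%N -> 0 <= x j).

Definition hive_boundary (n : nat) (mu nu la : intpart) (a : labelling n) :
    Prop :=
  forall i, (1 <= i <= n)%N ->
    [/\ label a i i - label a i.-1 i.-1 = (part mu i)%:Z,
        label a (n + i) (n + i) - label a (n + i).-1 (n + i).-1 = (part nu i)%:Z
      & label a i (n + i) - label a i.-1 (n + i).-1 = (part la i)%:Z].

(* The three families of rhombi of the lattice, with indices shifted so as to
   be natural numbers: the usual (i, j) is (i.+1, j.+2) in the first family
   and (i.+1, j.+1) in the other two. *)
Definition hive_rhombi (n : nat) (a : labelling n) : Prop :=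
  forall i j : nat,
    [/\ rhombus a (i, j.+1) (i.+1, j.+1) (i.+1, j.+2) (i, j),
        rhombus a (i, j) (i.+1, j.+1) (i, j.+1) (i.+1, j)
      & rhombus a (i.+1, j) (i.+1, j.+1) (i, j) (i.+2, j.+1)].

Definition hive_matching (n : nat) (a : labelling n) : Prop :=
  forall j, (1 <= j <= n)%N ->
    label a 0 j - label a 0 j.-1
    = label a (n + j) (2 * n) - label a (n + j).-1 (2 * n).

Definition hive_inner (n : nat) (a : labelling n) : Prop :=
  [/\ partition_seq n (fun j => label a 0 j - label a 0 j.-1),
      partition_seq n (fun j => label a j n - label a j.-1 n)
    & partition_seq n (fun j => label a n (n + j) - label a n (n + j).-1)].

Definition composite_hive (n : nat) (mu nu la : intpart) (a : labelling n) :
    Prop :=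
  [/\ label a 0 0 = 0, hive_boundary mu nu la a, hive_rhombi a,
      hive_matching a & hive_inner a].

Definition composite_hives (n : nat) (mu nu la : intpart) :
    set (labelling n) :=
  [set a | composite_hive mu nu la a]%classic.
Arguments composite_hives : clear implicits.

(* Main.v *)
(* Both sides are counted by semistandard tableaux with a lattice condition.

   A tableau is encoded by the numbers [v k j] of entries smaller than [j] in
   row [k]; these form a Gelfand-Tsetlin pattern.  Multiplying the alternant
   of exponent [al + rho] by the Schur polynomial of [la] gives the sum of the
   alternants of exponents [al + rho + weight T] over all tableaux [T] of
   shape [la].  If [al] plus the content of [T], read row by row from right to
   left, fails at some point to be a partition, then reflecting the unread part
   of the guilty column of the pattern exchanges two exponents, so these terms
   cancel; this is the Littlewood-Richardson rule.

   The sums of the first [j] parts of [al] and of the first [i] entries of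
   column [j] of the pattern turn the interlacing conditions and the lattice
   condition into the three families of rhombus inequalities, so the tableaux
   that remain are the hives of a triangle, and a composite hive is a triple of
   hives with matching edges. *)

Require Import Defs.
From mathcomp Require Import all_boot all_order all_algebra.
From mathcomp Require Import fingroup perm.
From mathcomp Require Import finmap mpoly zify.
From mathcomp.classical Require Import boolp classical_sets cardinality fsbigop.

Set Implicit Arguments.
Unset Strict Implicit.
Unset Printing Implicit Defensive.

Import Order.TTheory GRing.Theory Num.Theory.

Local Open Scope nat_scope.

(** * Partitions, tableaux and patterns *)

Local Notation row la k := (nth 0 (parts la) k).

Lemma row_anti (la : intpart) i j : i <= j -> row la j <= row la i.
Proof.
move=> ij; have /andP[la_sorted _] := partsP la.
have [lt_j|ge_j] := ltnP j (size la); last by rewrite nth_default.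
apply: (sorted_leq_nth (leT := geq)) => //.
- by move=> a b c /= h1 h2; apply: leq_trans h1.
- by move=> a /=; exact: leqnn.
- by rewrite inE (leq_ltn_trans ij).
Qed.

Lemma row_gt0 (la : intpart) i : (0 < row la i) = (i < size la).
Proof.
have [lt_i|ge_i] := ltnP i (size la); last by rewrite nth_default.
have /andP[_ la0] := partsP la.
by rewrite lt0n; apply: contra la0 => /eqP <-; exact: mem_nth.
Qed.

Lemma row_default (la : intpart) i : size la <= i -> row la i = 0.
Proof. exact: nth_default. Qed.

Lemma row_head (la : intpart) i : row la i <= head 0 la.
Proof. by rewrite -nth0; exact: row_anti. Qed.

Lemma eq_row (la mu : intpart) : (forall i, row la i = row mu i) -> la = mu.
Proof.
move=> e; apply/val_inj/(@eq_from_nth _ 0) => [|i _]; last exact: e.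
have le a b : (forall i, row a i = row b i) -> size (parts a) <= size (parts b).
  by move=> eab; rewrite leqNgt -row_gt0 eab row_gt0 ltnn.
by apply/eqP; rewrite eqn_leq !le // => i; rewrite e.
Qed.

Definition intpart_nil : intpart := IntPart (parts := [::]) isT.

(** Zeros are dropped because a partition stores only nonzero parts; if the remaining values are not
    weakly decreasing, the result is the empty partition. *)
Definition intpart_of (N : nat) (f : nat -> nat) : intpart :=
  insubd intpart_nil [seq x <- mkseq f N | x != 0].

Lemma row_intpart_of N f : (forall i, f i.+1 <= f i) ->
  (forall i, N <= i -> f i = 0) -> forall i, row (intpart_of N f) i = f i.
Proof.
move=> f_anti f0 i.
have anti a b : a <= b -> f b <= f a.
  by move=> /subnK <-; elim: (b - a) => //= d; exact: leq_trans (f_anti _).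
have part_f : is_partition [seq x <- mkseq f N | x != 0].
  rewrite /is_partition mem_filter eqxx andbT.
  apply: sorted_filter; first by move=> x y z /= h1 h2; apply: leq_trans h1.
  case: N {f0} => // N; apply/(sortedP 0) => j; rewrite size_mkseq => lt_j.
  by rewrite !nth_mkseq ?(ltnW lt_j) //=; exact: f_anti.
rewrite /intpart_of /insubd insubT //=.
(* [p] is the first zero of [f]: the filter keeps all values before it and drops all later ones. *)
have [p [pN fp fp0]] : exists p, [/\ p <= N, forall j, j < p -> f j != 0
    & forall j, p <= j -> f j = 0].
  have ex : exists p, f p == 0 by exists N; rewrite f0.
  exists (ex_minn ex); case: ex_minnP => p /eqP fp min_p; split.
  - by apply: min_p; rewrite f0.
  - by move=> j; rewrite ltnNge; apply: contra; exact: min_p.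
  - by move=> j /anti; rewrite fp leqn0 => /eqP.
rewrite /mkseq -(subnKC pN) iotaD map_cat filter_cat.
have -> : [seq x <- [seq f j | j <- iota 0 p] | x != 0] = [seq f j | j <- iota 0 p].
  by apply/all_filterP/allP => x /mapP[j]; rewrite mem_iota => /fp ? ->.
have -> : [seq x <- [seq f j | j <- iota (0 + p) (N - p)] | x != 0] = [::].
  apply/eqP; rewrite -(negbK (_ == _)) -has_filter; apply/hasPn => x /mapP[j].
  by rewrite mem_iota => /andP[/fp0 -> _] ->.
rewrite cats0; have [lt_i|ge_i] := ltnP i p.
  by rewrite (nth_map 0) ?size_iota // nth_iota.
by rewrite nth_default ?size_map ?size_iota // fp0.
Qed.

Lemma size_le_row (la : intpart) n : (size la <= n) = (row la n == 0).
Proof. by rewrite leqNgt -row_gt0 lt0n negbK. Qed.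

Section Cells.
Variable la : intpart.
Implicit Types c d : cell la.

Lemma col_lt c : col_of c < row la (row_of c).
Proof. exact: (valP c). Qed.

Lemma cell_exists k m : m < row la k ->
  exists c, row_of c = k /\ col_of c = m.
Proof.
move=> lt_m; have k_lt : k < size la by rewrite -row_gt0; case: (row la k) lt_m.
have m_lt : m < head 0 la by exact: leq_trans lt_m (row_head _ _).
by exists (Sub (Ordinal k_lt, Ordinal m_lt) lt_m).
Qed.

Lemma cell_eq c d : row_of c = row_of d -> col_of c = col_of d -> c = d.
Proof.
move=> e1 e2; apply/val_inj; rewrite (surjective_pairing (val c)).
rewrite (surjective_pairing (val d)).
by congr pair; apply/val_inj.
Qed.

Lemma card_row_segment k m : m <= row la k ->
  #|[set c : cell la | (row_of c == k) && (col_of c < m)]| = m.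
Proof.
move=> le_m; set A := finset _.
rewrite -(card_in_imset (f := fun c : cell la => (val c).2)); last first.
  move=> c d; rewrite !inE => /andP[/eqP rc _] /andP[/eqP rd _] e.
  by apply: cell_eq; rewrite ?rc ?rd // /col_of e.
have -> : [set (val x).2 | x in A] = [set i : 'I_(head 0 la) | i < m].
  apply/setP => i; rewrite inE; apply/imsetP/idP => [[c]|lt_i].
    by rewrite !inE => /andP[_ ?] ->.
  have [c [rc cc]] := cell_exists (leq_trans lt_i le_m).
  by exists c; [rewrite !inE rc cc eqxx | apply/val_inj].
rewrite cardsE cardE size_filter -(count_map val (fun i => i < m)).
rewrite -enumT val_enum_ord.
have -> : head 0 la = m + (head 0 la - m).
  by rewrite subnKC // (leq_trans le_m) // row_head.
rewrite iotaD count_cat.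
rewrite (_ : count _ (iota 0 m) = m); last first.
  rewrite -[RHS](size_iota 0 m); apply/eqP; rewrite -all_count; apply/allP => x.
  by rewrite mem_iota.
rewrite [X in _ + X](_ : _ = 0) ?addn0 //; apply/eqP; rewrite -leqn0 leqNgt -has_count.
by apply/hasPn => x; rewrite mem_iota -leqNgt => /andP[].
Qed.

End Cells.

(* [v k j] stands for the number of entries smaller than [j] in row [k] of a
   semistandard tableau of shape [la] with entries in [0, N[. *)
Record gt_pattern (N : nat) (la : intpart) (v : nat -> nat -> nat) : Prop :=
  GTPattern {
    gt_col0 : forall k, v k 0 = 0;
    gt_incr : forall k j, v k j <= v k j.+1;
    gt_interlace : forall k j, v k.+1 j.+1 <= v k j;
    gt_shape : forall k j, N <= j -> v k j = row la k }.

Section PatternFacts.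
Variables (N : nat) (la : intpart) (v : nat -> nat -> nat).
Hypothesis gt_v : gt_pattern N la v.

Lemma gt_mono k i j : i <= j -> v k i <= v k j.
Proof.
by move=> /subnK <-; elim: (j - i) => //= d h; apply: leq_trans h (gt_incr gt_v _ _).
Qed.

Lemma gt_anti i k j : i <= k -> v k j <= v i j.
Proof.
move=> /subnK <-; elim: (k - i) => //= d h; apply: leq_trans h.
exact: leq_trans (gt_incr gt_v _ _) (gt_interlace gt_v _ _).
Qed.

Lemma gt_strict i k j : i < k -> v k j.+1 <= v i j.
Proof. by case: k => // k le_ik; apply: leq_trans (gt_interlace gt_v _ _) (gt_anti _ _). Qed.

Lemma gt_le_row k j : v k j <= row la k.
Proof.
have [?|?] := leqP N j; first by rewrite (gt_shape gt_v).
by rewrite -(gt_shape gt_v k (leqnn N)); apply/gt_mono/ltnW.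
Qed.

Lemma gt_size k j : size la <= k -> v k j = 0.
Proof. by move=> h; apply/eqP; rewrite -leqn0 -(row_default h) gt_le_row. Qed.

(** Columns of a tableau increase strictly, so no entry of row [k] is smaller than [k]. *)
Lemma gt_diag k j : j <= k -> v k j = 0.
Proof.
elim: k j => [|k IH] [|j] h; rewrite ?(gt_col0 gt_v) //.
by apply/eqP; rewrite -leqn0 -(IH j h) (gt_interlace gt_v).
Qed.

Lemma gt_size_le : size la <= N.
Proof. by rewrite size_le_row -(gt_shape gt_v _ (leqnn N)) gt_diag. Qed.

End PatternFacts.

(** * Semistandard tableaux as Gelfand-Tsetlin patterns *)

Section TableauPattern.
Variables (N : nat) (la : intpart).
Implicit Type T : {ffun cell la -> 'I_N}.

Definition pattern T (k j : nat) : nat :=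
  #|[set c | (row_of c == k) && (T c < j)]|.

Lemma ssytP T : reflect
  ((forall c d, row_of c = row_of d -> col_of c < col_of d -> T c <= T d) /\
   (forall c d, col_of c = col_of d -> row_of c < row_of d -> T c < T d))
  (is_ssyt T).
Proof.
apply: (iffP forallP) => [h|[h1 h2] c].
  split=> c d e lt_cd; have /forallP/(_ d)/andP[] := h c; rewrite e eqxx lt_cd //=.
apply/forallP => d; apply/andP; split; apply/implyP => /andP[/eqP e lt_cd].
  exact: h1.
exact: h2.
Qed.

(** Rows increase weakly, so the entries smaller than [j] fill an initial segment of the row. A
    tableau can thus be read back from its pattern. *)
Lemma ssyt_lt_pattern T c j : is_ssyt T ->
  (T c < j) = (col_of c < pattern T (row_of c) j).
Proof.
move=> /ssytP[wkT _].
have wk d d' : row_of d = row_of d' -> col_of d <= col_of d' -> T d <= T d'.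
  move=> e; rewrite leq_eqVlt => /orP[/eqP e'|]; last exact: wkT.
  by rewrite (cell_eq e e').
have [lt_T|le_T] := ltnP (T c) j; apply/esym.
  rewrite -[X in X <= _](card_row_segment (col_lt c)); apply/subset_leq_card.
  apply/fintype.subsetP => d; rewrite !inE ltnS => /andP[/eqP e /(wk _ _ e) h].
  by rewrite e eqxx (leq_ltn_trans h).
apply/negbTE; rewrite -leqNgt -[X in _ <= X](card_row_segment (ltnW (col_lt c))).
apply/subset_leq_card/fintype.subsetP => d; rewrite !inE => /andP[/eqP e lt_d].
rewrite e eqxx ltnNge /=; apply: contraL lt_d => /(wk _ _ (esym e)) h.
by rewrite -leqNgt (leq_trans le_T).
Qed.

Lemma gt_of_ssyt T : is_ssyt T -> gt_pattern N la (pattern T).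
Proof.
move=> ssT; have /ssytP[_ strT] := ssT.
have shape k j : N <= j -> pattern T k j = row la k.
  move=> le_j; rewrite -[RHS](card_row_segment (leqnn (row la k))); apply/eq_card => c.
  rewrite !inE (leq_trans (ltn_ord (T c)) le_j).
  by case: eqP => // <-; rewrite col_lt.
have mono k i j : i <= j -> pattern T k i <= pattern T k j.
  move=> le_ij; apply/subset_leq_card/fintype.subsetP => c.
  by rewrite !inE => /andP[-> /leq_trans->].
have le_row k j : pattern T k j <= row la k.
  by rewrite -(shape k _ (leq_maxl N j)); apply/mono/leq_maxr.
split=> // [k|k j|k j].
- by rewrite /pattern; apply: eq_card0 => c; rewrite !inE ltn0 andbF.
- exact: mono.
(* Otherwise, in column [pattern T k j], the cell of row [k.+1] has an entry at most [j] and the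
   cell above it an entry at least [j]. *)
- rewrite leqNgt; apply/negP => lt_v.
  have lt_m := leq_trans lt_v (le_row _ _).
  have [c [rc cc]] := cell_exists lt_m.
  have [d [rd cd]] := cell_exists (leq_trans lt_m (row_anti la (leqnSn k))).
  have := strT d c; rewrite rc cc rd cd ltnSn => /(_ erefl isT).
  have : T c < j.+1 by rewrite (ssyt_lt_pattern _ _ ssT) rc cc.
  rewrite ltnS => h1 h2; have := leq_trans h2 h1.
  by rewrite (ssyt_lt_pattern _ _ ssT) rd cd ltnn.
Qed.

Lemma pattern_inj T T' : is_ssyt T -> is_ssyt T' ->
  pattern T =2 pattern T' -> T = T'.
Proof.
move=> ssT ssT' e; apply/ffunP => c; apply/val_inj/eqP; rewrite eqn_leq.
apply/andP; split; rewrite -ltnS ssyt_lt_pattern //.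
  by rewrite e -ssyt_lt_pattern.
by rewrite -e -ssyt_lt_pattern.
Qed.

Lemma ssyt_of_gt v : gt_pattern N la v ->
  exists T, is_ssyt T /\ pattern T =2 v.
Proof.
move=> gt_v.
have /fin_all_exists[T hT] (c : cell la) :
    exists t : 'I_N, forall j, (t < j) = (col_of c < v (row_of c) j).
  have ex : exists j, col_of c < v (row_of c) j.
    by exists N; rewrite (gt_shape gt_v) // col_lt.
  (* The entry is the predecessor [t] of the least such [j], which is not 0 because column 0 of the
     pattern vanishes. *)
  case: (ex_minnP ex) => -[|t] lt_t min_t; first by rewrite (gt_col0 gt_v) in lt_t.
  have lt_tN : t < N by apply: min_t; rewrite (gt_shape gt_v) // col_lt.
  exists (Ordinal lt_tN) => j; apply/idP/idP => [lt_tj|]; last exact: min_t.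
  exact: leq_trans lt_t (gt_mono gt_v _ lt_tj).
exists [ffun c => T c]; split.
  apply/ssytP; split=> c d e lt_cd; rewrite !ffunE.
    rewrite -ltnS hT; apply: ltn_trans lt_cd _.
    by rewrite e -hT.
  rewrite hT e; apply: leq_trans (gt_strict gt_v _ lt_cd).
  by rewrite -hT.
move=> k j; rewrite -[RHS](card_row_segment (gt_le_row gt_v k j)); apply: eq_card => c.
by rewrite !inE ffunE hT; case: eqP => // ->.
Qed.

End TableauPattern.

(** * Reflecting a column of a pattern *)

(** A symmetric functional relation, total on [P], is the graph of an involution, along which the
    sum is reindexed. A relation is convenient because tableaux are obtained from patterns only by
    existence. With [G] equal to [- F] this yields a cancellation. *)
Lemma sum_matching (I : finType) (V : zmodType) (P : pred I)
    (R : I -> I -> Prop) (F G : I -> V) :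
    (forall x, P x -> exists y, R x y) ->
    (forall x y, R x y -> R y x) ->
    (forall x y z, R x y -> R x z -> y = z) ->
    (forall x y, R x y -> P x) ->
    (forall x y, R x y -> F x = G y) ->
  (\sum_(x | P x) F x = \sum_(x | P x) G x)%R.
Proof.
(* Outside [P] nothing is related to [x], so the default value makes [phi] the identity there. *)
move=> exR symR funR subR FG; pose phi x := xget x (R x).
have phiE x y : R x y -> phi x = y.
  by move=> xy; apply: (funR x) => //; exact: (xgetPex x (ex_intro _ y xy)).
have phi_out x : ~~ P x -> phi x = x.
  move=> nPx; rewrite /phi; case: xgetP => // y _ xy; by rewrite (subR _ _ xy) in nPx.
rewrite [RHS](reindex_onto phi phi); last first.
  by move=> x /exR[y xy]; rewrite (phiE _ _ xy); exact/phiE/symR.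
apply: eq_big => x; last by move=> /exR[y xy]; rewrite (phiE _ _ xy); exact: FG.
have [Px|nPx] := boolP (P x); last by rewrite phi_out // (negbTE nPx).
have [y xy] := exR x Px; rewrite (phiE _ _ xy) (phiE _ _ (symR _ _ xy)) eqxx.
by rewrite (subR _ _ (symR _ _ xy)).
Qed.

Definition psum (v : nat -> nat -> nat) (i j : nat) : nat := \sum_(k < i) v k j.

Lemma psum0 v j : psum v 0 j = 0.
Proof. exact: big_ord0. Qed.

Lemma psumS v i j : psum v i.+1 j = psum v i j + v i j.
Proof. exact: big_ord_recr. Qed.

Lemma eq_psum v w i j : (forall k, k < i -> v k j = w k j) -> psum v i j = psum w i j.
Proof. by move=> e; apply: eq_bigr => k _; exact: e. Qed.

Lemma psum_stable N la v i j : gt_pattern N la v -> size la <= i ->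
  psum v i j = psum v (size la) j.
Proof.
move=> gt_v /subnK <-; elim: (i - size la) => //= d IH.
by rewrite addSn psumS IH (gt_size gt_v) ?addn0 // leq_addl.
Qed.

Lemma psum_pattern N la (T : {ffun cell la -> 'I_N}) j :
  psum (pattern T) (size la) j = #|[set c | T c < j]|.
Proof.
rewrite -[RHS]sum1_card.
rewrite (partition_big (fun c : cell la => (val c).1) xpredT) //=.
apply: eq_bigr => k _; rewrite -[LHS]sum1_card; apply: eq_bigl => c.
by rewrite !inE andbC.
Qed.

Definition weight N la (T : {ffun cell la -> 'I_N}) (i : nat) : nat :=
  #|[set c | T c == i :> nat]|.

Lemma psum_weight N la (T : {ffun cell la -> 'I_N}) i :
  psum (pattern T) (size la) i.+1 = psum (pattern T) (size la) i + weight T i.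
Proof.
rewrite !psum_pattern -[LHS](cardsID [set c | T c < i]); congr (_ + _).
  by apply: eq_card => c; rewrite !inE; lia.
by apply: eq_card => c; rewrite !inE; lia.
Qed.

(* Column [j.+1] of a pattern, from row [r] on, is reflected in the interval
   that the neighbouring columns allow; in row [r] the upper end of that
   interval is replaced by [U].  With [r = 0] and [U = v 0 j.+2] this is the
   Bender-Knuth involution. *)
Definition toggle (v : nat -> nat -> nat) (r j U k i : nat) : nat :=
  if (i == j.+1) && (r <= k) then
    maxn (v k.+1 j.+2) (v k j)
    + (if k == r then U else minn (v k j.+2) (v k.-1 j)) - v k j.+1
  else v k i.

Section Toggle.
Variables (N : nat) (la : intpart) (v : nat -> nat -> nat) (r j U : nat).
Hypotheses (gt_v : gt_pattern N la v) (ltjN : j.+1 < N).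
Hypotheses (leU : v r j.+1 <= U) (Ule : U <= v r j.+2).
Hypothesis (Ule' : 0 < r -> U <= v r.-1 j).
Local Notation w := (toggle v r j U).

Lemma toggle_out k i : i != j.+1 -> w k i = v k i.
Proof. by rewrite /toggle => /negbTE->. Qed.

Lemma toggle_above k i : k < r -> w k i = v k i.
Proof. by move=> h; rewrite /toggle leqNgt h andbF. Qed.

Lemma toggle_below k : r < k ->
  w k j.+1 = maxn (v k.+1 j.+2) (v k j) + minn (v k j.+2) (v k.-1 j) - v k j.+1.
Proof. by move=> h; rewrite /toggle eqxx (ltnW h) gtn_eqF. Qed.

(** The old entry lies below the upper end of its interval, so the subtraction in [toggle] is exact
    and the reflected entry stays above the lower end. *)
Lemma toggle_ge k : r <= k -> maxn (v k.+1 j.+2) (v k j) <= w k j.+1.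
Proof.
rewrite /toggle eqxx => rk; rewrite rk /=.
have := gt_incr gt_v k j.+1; have := gt_interlace gt_v k.-1 j.
case: eqP => [->|]; first by move: leU; lia.
by case: k rk => [|k]; [lia | rewrite /=; lia].
Qed.

Lemma toggle_le k : r <= k ->
  w k j.+1 <= (if k == r then U else minn (v k j.+2) (v k.-1 j)).
Proof.
rewrite /toggle eqxx => rk; rewrite rk /=.
have := gt_incr gt_v k j; have := gt_interlace gt_v k j.+1.
by case: eqP => [->|]; lia.
Qed.

Lemma gt_toggle : gt_pattern N la w.
Proof.
split=> [k|k i|k i|k i leNi].
- by rewrite toggle_out // (gt_col0 gt_v).
- have [ltkr|lerk] := ltnP k r; first by rewrite !toggle_above // (gt_incr gt_v).
  have [->|ni] := eqVneq i j.+1.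
    rewrite [w k j.+2]toggle_out; last by lia.
    have := toggle_le lerk; case: eqP => [->|_]; last by lia.
    by move=> h; apply: leq_trans h Ule.
  rewrite [w k i]toggle_out //; have [e|ni'] := eqVneq i.+1 j.+1.
    rewrite e; case: e => ->; have := toggle_ge lerk; lia.
  by rewrite toggle_out // (gt_incr gt_v).
- have [->|ni] := eqVneq i j.+1.
    rewrite [w k.+1 j.+2]toggle_out; last by lia.
    have [ltkr|lerk] := ltnP k r; first by rewrite toggle_above // (gt_interlace gt_v).
    by have := toggle_ge lerk; lia.
  rewrite [w k i]toggle_out //; have [e|ni'] := eqVneq i.+1 j.+1.
    rewrite e; case: e => ->.
    have [ltkr|lerk] := ltnP k.+1 r; first by rewrite toggle_above // (gt_interlace gt_v).
    have := toggle_le lerk => /=; case: eqP => [e|_]; last by lia.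
    (* Here [k.+1] is the first reflected row [r], and the second bound on [U] keeps it interlaced
       with the untouched row above. *)
    by move=> h; apply: leq_trans h _; have := Ule'; rewrite -e; apply.
  by rewrite toggle_out // (gt_interlace gt_v).
- by rewrite toggle_out ?(gt_shape gt_v) //; lia.
Qed.

Lemma toggleK : toggle w r j U =2 v.
Proof.
move=> k i; rewrite {1}/toggle; case: ifP => [/andP[/eqP-> rk]|ne].
  rewrite !(@toggle_out _ j.+2) ?(@toggle_out _ j); try lia.
  rewrite /toggle eqxx rk /=.
  have := gt_incr gt_v k j; have := gt_interlace gt_v k j.+1.
  have := gt_incr gt_v k j.+1; have := gt_interlace gt_v k.-1 j.
  case: eqP => [->|]; first by move: leU; lia.
  by case: k rk  => [|k] /=; lia.
by rewrite /toggle ne.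
Qed.

Lemma psum_toggle_out M i : i != j.+1 -> psum w M i = psum v M i.
Proof. by move=> ni; apply: eq_psum => k _; rewrite toggle_out. Qed.

(* The upper end of the interval of row [k.+1] and the lower end of that of
   row [k] add up to [v k.+1 j.+2 + v k j], so the sums telescope. *)
Lemma psum_toggle :
  psum w (size la) j.+1 + psum v (size la) j.+1 + psum v r.+1 j.+2 + psum v r j
  = psum v r j.+1 * 2 + U + psum v (size la) j.+2 + psum v (size la) j.
Proof.
(* The telescoping leaves the lower end of the last row as a remainder, which vanishes once that row
   has index at least [size la]. *)
have tele d : let M := (r + d).+1 in
    psum w M j.+1 + psum v M j.+1 + psum v r.+1 j.+2 + psum v r j
  = psum v r j.+1 * 2 + U + psum v M j.+2 + psum v M.-1 j
    + maxn (v M j.+2) (v M.-1 j).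
  elim: d => [|d IH] /=.
    rewrite addn0 !psumS (_ : psum w r _ = psum v r j.+1); last first.
      by apply: eq_psum => k ltkr; rewrite toggle_above.
    rewrite /toggle !eqxx leqnn /=.
    have := gt_incr gt_v r j; have := gt_interlace gt_v r j.+1; lia.
  rewrite addnS [psum w _ _]psumS [psum v _.+2 j.+1]psumS [psum v _.+2 j.+2]psumS.
  rewrite [psum v _.+1 j]psumS.
  move: IH => /=; rewrite toggle_below /=; last by lia.
  have := gt_incr gt_v (r + d).+1 j; have := gt_interlace gt_v (r + d).+1 j.+1.
  have := gt_incr gt_v (r + d).+1 j.+1; have := gt_interlace gt_v (r + d) j.
  by lia.
have := tele (size la); cbv zeta.
have le_M : size la <= r + size la by lia.
rewrite (psum_stable _ gt_toggle) ?(psum_stable _ gt_v (i := (_ + _).+1)) //=; try lia.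
by rewrite !(gt_size gt_v) ?(psum_stable _ gt_v le_M) //; lia.
Qed.

End Toggle.

(** Without subtractions, this says that [row al j] plus the number of entries [j] in the rows
    before [r] is less than [row al j.+1] plus the number of entries [j.+1] in the rows up to [r].
    From right to left, the entries [j.+1] of row [r] are read before its entries [j]. *)
Definition lattice_fail (al : intpart) v (r j : nat) : bool :=
  row al j + psum v r j.+1 + psum v r.+1 j.+1
  < row al j.+1 + psum v r.+1 j.+2 + psum v r j.

(* Reading the rows from top to bottom, each from right to left, this is the
   first place where [al] plus the content read so far fails to be a partition. *)
Definition first_fail (al : intpart) v (r j : nat) : Prop :=
  [/\ lattice_fail al v r j,
      forall r' j', r' < r -> ~~ lattice_fail al v r' j'
    & forall j', j < j' -> ~~ lattice_fail al v r j'].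

(** At a first failure this is the column of the guilty cell. With [m] the excess of entry [j] over
    entry [j.+1] of [al] plus the content of the rows before [r], the failure occurs at the cell
    [m + 1] among the entries [j.+1] of row [r], counted from their right end [v r j.+2]. *)
Definition flip_end (al : intpart) v (r j : nat) : nat :=
  v r j.+2 + (row al j.+1 + psum v r j + psum v r j.+2)
  - (row al j + psum v r j.+1 * 2).+1.

Definition flip_rel (al : intpart) v w : Prop :=
  exists r j, first_fail al v r j /\ w =2 toggle v r j (flip_end al v r j).

Lemma eq_psum2 v w i j : v =2 w -> psum v i j = psum w i j.
Proof. by move=> e; apply: eq_psum => k _; exact: e. Qed.

Lemma eq_lattice_fail al v w r j : v =2 w ->
  lattice_fail al v r j = lattice_fail al w r j.
Proof. by move=> e; rewrite /lattice_fail !(eq_psum2 _ _ e). Qed.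

Section Flip.
Variables (N : nat) (al la : intpart).
Hypothesis al_le : size al <= N.
Implicit Types v w : nat -> nat -> nat.

(** From column [N] on the pattern is constant, and [al] has no parts there, so nothing can fail. *)
Lemma lattice_fail_lt v r j : gt_pattern N la v -> lattice_fail al v r j -> j.+1 < N.
Proof.
move=> gt_v; rewrite ltnNge /lattice_fail; apply: contraL => leN.
rewrite (@row_default al j.+1); last exact: leq_trans leN.
have e i : psum v i j.+2 = psum v i j.+1.
  by apply: eq_bigr => k _; rewrite !(gt_shape gt_v) //; lia.
have : psum v r j <= psum v r j.+1 by apply: leq_sum => k _; exact: gt_incr gt_v _ _.
rewrite e; lia.
Qed.

Lemma first_fail_exists v r j : gt_pattern N la v -> lattice_fail al v r j ->
  exists r' j', first_fail al v r' j'.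
Proof.
move=> gt_v bad.
pose fails r := [exists j : 'I_N, lattice_fail al v r j].
have failsP r1 j1 : lattice_fail al v r1 j1 -> fails r1.
  move=> h; apply/existsP; exists (Ordinal (ltnW (lattice_fail_lt gt_v h))).
  exact: h.
have ex : exists r, fails r by exists r; exact: failsP bad.
case: (ex_minnP ex) => r1 /existsP[j1 bad1] min_r1.
have bound i : lattice_fail al v r1 i -> i <= N.
  by move=> /(lattice_fail_lt gt_v); lia.
(* A row is read from right to left, so its failure with the largest [j] is met first. *)
case: (ex_maxnP (ex_intro _ (j1 : nat) bad1) bound) => j2 bad2 max_j2.
exists r1, j2; split=> // [r' j' lt_r'|j' lt_j'].
  by apply/negP => /failsP/min_r1; lia.
by apply/negP => /max_j2; lia.
Qed.

(** The failure gives the lower bound. The upper bounds hold because the row above did not fail or,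
    for [r = 0], because [al] decreases. The equation says that the subtraction in [flip_end] is
    exact. *)
Lemma flip_end_bounds v r j : gt_pattern N la v -> first_fail al v r j ->
  [/\ v r j.+1 <= flip_end al v r j, flip_end al v r j <= v r j.+2,
      0 < r -> flip_end al v r j <= v r.-1 j &
      flip_end al v r j + (row al j + psum v r j.+1 * 2).+1
      = v r j.+2 + (row al j.+1 + psum v r j + psum v r j.+2)].
Proof.
move=> gt_v [bad top _]; have := bad; rewrite /lattice_fail !psumS /flip_end => bad'.
have al_anti := row_anti al (leqnSn j).
case: r bad top bad' => [|r] bad top bad'.
  by move: bad'; rewrite !psum0; split; lia.
have := top r j (leqnn _); rewrite /lattice_fail -leqNgt => okr.
have i1 := gt_interlace gt_v r j.+1; have i2 := gt_incr gt_v r j.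
move: okr bad'; rewrite !psumS /=.
by split; lia.
Qed.

Lemma flip_end_toggle v r j U :
  flip_end al (toggle v r j U) r j = flip_end al v r j.
Proof.
rewrite /flip_end toggle_out; last by lia.
rewrite !(@eq_psum (toggle v r j U) v) // => k ltk; exact: toggle_above.
Qed.

(** The word read up to the guilty cell is unchanged: the rows above stay the same, and in row [r]
    only cells to the left of that cell are affected. The same failure is therefore found again,
    which makes the flip an involution. *)
Lemma first_fail_toggle v r j : gt_pattern N la v -> first_fail al v r j ->
  first_fail al (toggle v r j (flip_end al v r j)) r j.
Proof.
move=> gt_v ff; have [leU Ule Ule' defU] := flip_end_bounds gt_v ff.
have [bad top rgt] := ff; set U := flip_end _ _ _ _ in leU Ule Ule' defU *.
have above r' i : r' <= r -> psum (toggle v r j U) r' i = psum v r' i.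
  by move=> h; apply: eq_psum => k ltk; apply: toggle_above; lia.
have ltN := lattice_fail_lt gt_v bad.
split=> [|r' j' ltr'|j' ltj'].
- rewrite /lattice_fail !psumS !above // [toggle v r j U r j.+2]toggle_out; last by lia.
  have -> : toggle v r j U r j.+1 = maxn (v r.+1 j.+2) (v r j) + U - v r j.+1.
    by rewrite /toggle !eqxx leqnn.
  have := gt_incr gt_v r j; have := gt_interlace gt_v r j.+1.
  by lia.
- by have := top r' j' ltr'; rewrite /lattice_fail !above //; lia.
- have := rgt j' ltj'; rewrite /lattice_fail !psumS !above //.
  by rewrite !toggle_out //; lia.
Qed.

Lemma first_fail_inj v r j r' j' :
  first_fail al v r j -> first_fail al v r' j' -> r = r' /\ j = j'.
Proof.
move=> [b1 t1 g1] [b2 t2 g2].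
have er : r = r'.
  case: (ltngtP r r') => // h; first by rewrite (negbTE (t2 _ j h)) in b1.
  by rewrite (negbTE (t1 _ j' h)) in b2.
split=> //; subst r'; case: (ltngtP j j') => // h.
  by rewrite (negbTE (g1 _ h)) in b2.
by rewrite (negbTE (g2 _ h)) in b1.
Qed.

Lemma eq_first_fail v w r j : v =2 w -> first_fail al v r j -> first_fail al w r j.
Proof.
move=> e [h1 h2 h3]; split=> [|r' j' h|j' h]; rewrite -(eq_lattice_fail _ _ _ e) //.
  exact: h2.
exact: h3.
Qed.

Lemma eq_toggle v w r j U : v =2 w -> toggle v r j U =2 toggle w r j U.
Proof. by move=> e k i; rewrite /toggle !e. Qed.

Lemma eq_flip_end v w r j : v =2 w -> flip_end al v r j = flip_end al w r j.
Proof. by move=> e; rewrite /flip_end !(eq_psum2 _ _ e) e. Qed.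

Lemma flip_rel_sym v w : gt_pattern N la v -> flip_rel al v w -> flip_rel al w v.
Proof.
move=> gt_v [r [j [ff e]]]; exists r, j; split.
  apply: (@eq_first_fail (toggle v r j (flip_end al v r j))).
    by move=> k i; rewrite e.
  exact: first_fail_toggle.
have [leU Ule Ule' defU] := flip_end_bounds gt_v ff.
move=> k i; rewrite (eq_flip_end _ _ e) (eq_toggle _ _ _ e) flip_end_toggle.
have [bad _ _] := ff.
by rewrite (toggleK gt_v (lattice_fail_lt gt_v bad) leU Ule Ule').
Qed.

Lemma flip_rel_fun v w w' : flip_rel al v w -> flip_rel al v w' -> w =2 w'.
Proof.
move=> [r [j [ff e]]] [r' [j' [ff' e']]] k i; rewrite e e'.
by have [-> ->] := first_fail_inj ff ff'.
Qed.

(* The conclusion says that [w] exchanges the entries [j] and [j.+1] of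
   [al + rho + content]. *)
Lemma flip_rel_content v w : gt_pattern N la v -> flip_rel al v w ->
  exists j, [/\ j.+1 < N,
    forall i, i != j.+1 -> psum w (size la) i = psum v (size la) i
    & psum w (size la) j.+1 + psum v (size la) j.+1 + row al j + 1
      = psum v (size la) j + psum v (size la) j.+2 + row al j.+1].
Proof.
move=> gt_v [r [j [ff e]]]; have [leU Ule Ule' defU] := flip_end_bounds gt_v ff.
have [bad _ _] := ff; have ltN := lattice_fail_lt gt_v bad.
exists j; split=> // [i ni|]; rewrite (eq_psum2 _ _ e).
  exact: psum_toggle_out.
have := psum_toggle gt_v ltN leU Ule Ule'.
by rewrite psumS; lia.
Qed.

End Flip.

(** * Alternants and Schur polynomials *)

Local Open Scope ring_scope.

(** A longer transposition is a conjugate of a shorter one by an adjacent one, and transpositions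
    generate all permutations. *)
Lemma symmetric_adjacent N (p : {mpoly int[N]}) :
    (forall i j : 'I_N, j = i.+1 :> nat -> msym (tperm i j) p = p) ->
  p \is symmetric.
Proof.
move=> adj; apply/issymP => s.
have tp d : forall i j : 'I_N, j = (i + d.+1)%N :> nat -> msym (tperm i j) p = p.
  elim: d => [|d IH] i j ej; first by apply: adj; lia.
  have ltkN : (i + d.+1 < N)%N by have := ltn_ord j; lia.
  pose k := Ordinal ltkN.
  have nij : k != i by apply/eqP => /(congr1 val) /=; lia.
  have nkj : j != i by apply/eqP => /(congr1 val) /=; lia.
  have -> : tperm i j = (tperm i k ^ tperm k j)%g by rewrite tpermJ tpermL tpermD.
  by rewrite conjgE tpermV !msymMm (adj k j) ?(IH i k) ?(adj k j) //=; lia.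
have [ts -> /allP ts_d] := prod_tpermP s.
elim: ts ts_d => [|[i j] ts IH] ts_d; first by rewrite big_nil msym1m.
rewrite big_cons msymMm /=.
have -> : msym (tperm i j) p = p; last by apply: IH => t h; apply: ts_d; rewrite inE h orbT.
have /ts_d : (i, j) \in (i, j) :: ts by rewrite inE eqxx.
rewrite /dpair /= => nij; case: (ltngtP i j) => h.
- by apply: (tp (j - i).-1); lia.
- by rewrite tpermC; apply: (tp (i - j).-1); lia.
- by move: nij; rewrite (val_inj h) eqxx.
Qed.

Section Alternants.
Variable N : nat.
Implicit Types (p q : {mpoly int[N]}) (f g : nat -> nat).

Definition alternate p : {mpoly int[N]} := \sum_(s : 'S_N) (-1) ^+ s *: msym s p.

Lemma alternate_sum (I : finType) (P : pred I) (F : I -> {mpoly int[N]}) :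
  alternate (\sum_(i | P i) F i) = \sum_(i | P i) alternate (F i).
Proof.
rewrite exchange_big; apply: eq_bigr => s _.
by rewrite [msym s _]raddf_sum scaler_sumr.
Qed.

Lemma alternateM p q : q \is symmetric -> alternate (p * q) = alternate p * q.
Proof.
move=> /issymP q_sym; rewrite mulr_suml; apply: eq_bigr => s _.
by rewrite msymM q_sym scalerAl.
Qed.

Lemma alternate_tperm (i j : 'I_N) p : i != j ->
  alternate (msym (tperm i j) p) = - alternate p.
Proof.
move=> nij; rewrite /alternate (reindex_inj (mulgI (tperm i j))) -sumrN /=.
apply: eq_bigr => s _; rewrite -msymMm mulgA tperm2 mul1g.
by rewrite odd_mul_tperm nij signr_addb expr1 mulN1r scaleNr.
Qed.

Definition expo f : 'X_{1..N} := [multinom f i | i < N].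

Lemma expo_tperm f g (i j : 'I_N) :
    (forall k, k < N -> k != i -> k != j -> f k = g k)%N -> f i = g j -> f j = g i ->
  'X_[expo f] = msym (tperm i j) 'X_[expo g] :> {mpoly int[N]}.
Proof.
move=> out fi fj; rewrite msymX tpermV; congr 'X_[_]; apply/mnmP => k.
rewrite !mnmE; case: tpermP => [->|->|/eqP ki /eqP kj] //.
exact: out.
Qed.

Lemma alternate_swap f g j : (j.+1 < N)%N ->
    (forall k, k < N -> k != j -> k != j.+1 -> f k = g k)%N ->
    f j = g j.+1 -> f j.+1 = g j ->
  alternate 'X_[expo f] = - alternate 'X_[expo g].
Proof.
move=> ltN out fj fj1; rewrite (@expo_tperm f g (Ordinal (ltnW ltN)) (Ordinal ltN)) //.
by rewrite alternate_tperm //; apply/eqP => /(congr1 val) /=; lia.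
Qed.

(** This adds the exponent rho = (N-1, ..., 1, 0), which makes a weakly decreasing [f] strictly
    decreasing. *)
Definition shifted f i : nat := (f i + (N - i.+1))%N.

(** An increasing map never lowers an index; this applies to [s] and to its inverse. *)
Lemma increasing_perm (s : 'S_N) : (forall i j : 'I_N, i < j -> s i < s j)%N -> s = 1%g.
Proof.
have le (t : 'S_N) : (forall i j : 'I_N, i < j -> t i < t j)%N ->
    forall k (i : 'I_N), i = k :> nat -> (i <= t i)%N.
  move=> incr; elim=> [|k IH] i ei; first by rewrite ei.
  have ltk : (k < N)%N by have := ltn_ord i; lia.
  by have := IH (Ordinal ltk) erefl; have := incr (Ordinal ltk) i; rewrite /=; lia.
move=> incr; apply/permP => i; rewrite perm1; apply/val_inj/eqP.
rewrite eqn_leq (le _ incr _ i erefl) andbT.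
have incrV (a b : 'I_N) : (a < b -> (s^-1)%g a < (s^-1)%g b)%N.
  move=> lt_ab; rewrite ltnNge; apply/negP; rewrite leq_eqVlt => /orP[/eqP/val_inj e|/incr].
    by move/perm_inj: e lt_ab => ->; rewrite ltnn.
  by rewrite !permKV; lia.
by have := le _ incrV _ (s i) erefl; rewrite permK.
Qed.

(** Both exponents decrease strictly, so a permutation matching them is increasing, hence trivial.
    Alternants of distinct partitions are thereby linearly independent. *)
Lemma alternate_coeff f g :
    (forall i, f i.+1 <= f i)%N -> (forall i, g i.+1 <= g i)%N ->
  (alternate 'X_[expo (shifted f)])@_(expo (shifted g))
  = [forall i : 'I_N, f i == g i]%:R.
Proof.
move=> f_anti g_anti.
have dec h : (forall i, h i.+1 <= h i)%N ->
    forall i j, (i < j < N -> shifted h j < shifted h i)%N.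
  move=> h_anti i j /andP[lt_ij ltj]; rewrite /shifted.
  have : (h j <= h i)%N.
    move/ltnW: lt_ij => /subnK <-; elim: (j - i)%N => //= d; exact: leq_trans (h_anti _).
  lia.
rewrite raddf_sum (bigD1 1%g) //= big1 ?addr0 => [|s ns1].
  rewrite odd_perm1 expr0 scale1r msym1m mcoeffX; congr (_%:R); congr nat_of_bool.
  apply/eqP/forallP => [/mnmP e i|e].
    by have := e i; rewrite !mnmE /shifted; lia.
  by apply/mnmP => i; rewrite !mnmE /shifted (eqP (e i)).
rewrite mcoeffZ mcoeff_sym mcoeffX; case: eqP => [/mnmP e|]; last by rewrite mulr0.
case/eqP: ns1; apply: increasing_perm => i j lt_ij.
have ei := e i; have ej := e j; rewrite !mnmE in ei ej.
have := dec f f_anti i j; rewrite lt_ij ltn_ord ei ej => /(_ isT) lt_s.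
rewrite ltnNge leq_eqVlt; apply/negP => /orP[/eqP es|lt_s'].
  by rewrite es ltnn in lt_s.
by have := dec g g_anti (s j) (s i); rewrite lt_s' ltn_ord => /(_ isT); lia.
Qed.

End Alternants.

(** * Schur polynomials and their symmetry *)

Section SchurPoly.
Variables (N : nat) (la : intpart).

Lemma schurE : schur N la =
  \sum_(T : {ffun cell la -> 'I_N} | is_ssyt T) 'X_[expo N (weight T)].
Proof.
apply: eq_bigr => T _; rewrite mprodXE; congr 'X_[_]; apply/mnmP => i.
rewrite mnm_sumE mnmE /weight -sum1_card [RHS]big_mkcond /=; apply: eq_bigr => c _.
by rewrite mnm1E inE; case: eqP => [->|/eqP]; rewrite ?eqxx // => /negbTE; rewrite val_eqE => ->.
Qed.

Lemma schur_eq0 : (N < size la)%N -> schur N la = 0.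
Proof.
move=> ltN; rewrite schurE big_pred0 // => T; apply/negP => /gt_of_ssyt/gt_size_le.
by lia.
Qed.

(** The Bender-Knuth involution on column [i.+1] of the pattern exchanges the numbers of entries [i]
    and [i.+1]. *)
Lemma schur_symmetric : schur N la \is symmetric.
Proof.
apply: symmetric_adjacent => i j ej; rewrite schurE raddf_sum /=; apply/esym.
pose flip v := toggle v 0 i (v 0 i.+2)%N.
have flipK v : gt_pattern N la v -> flip (flip v) =2 v.
  move=> gt_v k l; rewrite {1}/flip /flip [X in toggle _ _ _ X]toggle_out; last by lia.
  apply: (toggleK (N := N) (la := la)) => //; first by have := ltn_ord j; lia.
  exact: gt_incr gt_v _ _.
have gt_flip v : gt_pattern N la v -> gt_pattern N la (flip v).
  move=> gt_v; apply: gt_toggle => //; first by have := ltn_ord j; lia.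
  exact: gt_incr gt_v _ _.
apply: (sum_matching (R := fun T T' => [/\ is_ssyt T, is_ssyt T' &
    pattern T' =2 flip (pattern T)])).
- move=> T ssT; have [T' [ssT' e]] := ssyt_of_gt (gt_flip _ (gt_of_ssyt ssT)).
  by exists T'.
- move=> T T' [ssT ssT' e]; split=> // k l.
  by rewrite -(flipK _ (gt_of_ssyt ssT)) /flip !(eq_toggle _ _ _ e) e.
- move=> T T1 T2 [_ ss1 e1] [_ ss2 e2]; apply: pattern_inj => // k l.
  by rewrite e1 e2.
- by move=> T T' [].
- move=> T T' [ssT ssT' e].
  have gt_v := gt_of_ssyt ssT.
  have ltN : (i.+1 < N)%N by have := ltn_ord j; lia.
  have pw := psum_weight T; have pw' := psum_weight T'.
  have out l : l != i.+1 -> psum (pattern T') (size la) l = psum (pattern T) (size la) l.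
    by move=> nl; rewrite (eq_psum2 _ _ e) psum_toggle_out.
  have nolt : (0 < 0 -> pattern T 0 i.+2 <= pattern T 0.-1 i)%N by [].
  (* For [r = 0] and this [U], the old and new sums of column [i.+1] add up to the sums of columns
     [i] and [i.+2]. *)
  have := psum_toggle gt_v ltN (gt_incr gt_v _ _) (leqnn _) nolt.
  rewrite -/(flip _) -(eq_psum2 _ _ e) !psum0 psumS psum0 => swap.
  have o0 := out i; have o2 := out i.+2.
  have := pw i; have := pw i.+1; have := pw' i; have := pw' i.+1.
  move=> w1 w2 w3 w4; apply: expo_tperm => [k ltk ki kj||]; rewrite ?ej.
  + have := pw k; have := pw' k; rewrite !out; lia.
  + by lia.
  + by lia.
Qed.

End SchurPoly.

Definition lattice_tableau N (al la : intpart) (T : {ffun cell la -> 'I_N}) : bool :=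
  is_ssyt T && `[< forall r j, ~~ lattice_fail al (pattern T) r j >].

(** The symmetric factor moves inside the antisymmetrisation, which leaves a sum over all tableaux;
    those that fail the lattice condition are paired by [flip_rel] with opposite terms. *)
Lemma alternate_mul_schur N (al la : intpart) : (size al <= N)%N ->
  alternate 'X_[expo N (shifted N (fun i => row al i))] * schur N la =
  \sum_(T : {ffun cell la -> 'I_N} | lattice_tableau al T)
     alternate 'X_[expo N (shifted N (fun i => row al i + weight T i)%N)].
Proof.
move=> al_le; rewrite -alternateM; last exact: schur_symmetric.
rewrite schurE mulr_sumr alternate_sum.
rewrite (bigID (fun T => `[< forall r j, ~~ lattice_fail al (pattern T) r j >])) /=.
rewrite addrC [X in X + _](_ : _ = 0) ?add0r; last first.
  (* The integers have no 2-torsion, so a sum equal to its opposite vanishes coefficient by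
     coefficient. *)
  set S := \sum_(_ | _) _; suff eS : S = - S.
    apply/mpolyP => m; have := congr1 (mcoeff m) eS; rewrite mcoeffN mcoeff0; lia.
  rewrite {2}/S -sumrN.
  apply: (sum_matching (R := fun T T' => [/\ is_ssyt T, is_ssyt T' &
    flip_rel al (pattern T) (pattern T')])).
  + move=> T /andP[ssT /asboolP/existsNP[r /existsNP[j /negP/negPn bad]]].
    have gt_v := gt_of_ssyt ssT.
    have [r' [j' ff]] := first_fail_exists al_le gt_v bad.
    have [leU Ule Ule' _] := flip_end_bounds al_le gt_v ff.
    have ltN : (j'.+1 < N)%N by case: ff => /(lattice_fail_lt al_le gt_v).
    have [T' [ssT' e]] := ssyt_of_gt (gt_toggle gt_v ltN leU Ule Ule').
    by exists T'; split=> //; exists r', j'.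
  + move=> T T' [ssT ssT' rel]; split=> //.
    exact: flip_rel_sym al_le _ _ (gt_of_ssyt ssT) rel.
  + move=> T T1 T2 [_ ss1 r1] [_ ss2 r2]; apply: pattern_inj => //.
    exact: flip_rel_fun r1 r2.
  + move=> T T' [-> _ [r [j [[bad _ _] _]]]] /=.
    by apply/asboolP => /(_ r j); rewrite bad.
  + move=> T T' [ssT ssT' rel]; rewrite -!mpolyXD.
    have [j [ltN out swap]] := flip_rel_content al_le (gt_of_ssyt ssT) rel.
    have pw := psum_weight T; have pw' := psum_weight T'.
    have e (T0 : {ffun cell la -> 'I_N}) : (expo N (shifted N (fun i => row al i)) +
       expo N (weight T0))%MM = expo N (shifted N (fun i => row al i + weight T0 i)%N).
      by apply/mnmP => i; rewrite mnmDE !mnmE /shifted; lia.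
    have o0 := out j; have o2 := out j.+2.
    have := pw j; have := pw j.+1; have := pw' j; have := pw' j.+1.
    move=> w1 w2 w3 w4; rewrite !e; apply: (alternate_swap ltN) => [k ltk kj kj1||].
    - have := pw k; have := pw' k; rewrite /shifted !out; lia.
    - by rewrite /shifted; lia.
    - by rewrite /shifted; lia.
apply: eq_bigr => T _; rewrite -mpolyXD; congr (alternate 'X_[_]).
by apply/mnmP => i; rewrite mnmDE !mnmE /shifted; lia.
Qed.

(** * The Littlewood-Richardson rule *)

(** This groups tableaux by shape and hives by inner partitions; the keys live in an infinite type,
    hence the list [s] of those that may occur. *)
Lemma sum_fiber (V : nmodType) (I J : eqType) (r : seq I) (P : pred I) (s : seq J)
    (key : I -> J) (F : I -> V) :
    uniq s -> (forall i, i \in r -> P i -> key i \in s) ->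
  \sum_(i <- r | P i) F i = \sum_(x <- s) \sum_(i <- r | P i && (key i == x)) F i.
Proof.
move=> s_uniq key_s; under [RHS]eq_bigr do rewrite big_mkcondr.
rewrite exchange_big [LHS]big_seq_cond [RHS]big_seq_cond; apply: eq_bigr => i /andP[i_r Pi].
rewrite (bigD1_seq (key i)) ?key_s //= eqxx big1 ?addr0 // => x.
by rewrite eq_sym => /negbTE->.
Qed.

Lemma intpart_nil_row i : row intpart_nil i = 0%N.
Proof. by case: i. Qed.

Lemma weight_default N (la : intpart) (T : {ffun cell la -> 'I_N}) i :
  (N <= i)%N -> weight T i = 0%N.
Proof.
move=> leN; apply: eq_card0 => c; rewrite !inE; apply/negbTE.
by have := ltn_ord (T c); lia.
Qed.

Section LatticeTableau.
Variables (N : nat) (al la : intpart) (T : {ffun cell la -> 'I_N}).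
Hypothesis lat_T : lattice_tableau al T.

Lemma lattice_tableau_ssyt : is_ssyt T.
Proof. by case/andP: lat_T. Qed.

Lemma lattice_tableauP r j :
  (row al j.+1 + psum (pattern T) r.+1 j.+2 + psum (pattern T) r j
   <= row al j + psum (pattern T) r j.+1 + psum (pattern T) r.+1 j.+1)%N.
Proof.
by case/andP: lat_T => _ /asboolP/(_ r j); rewrite /lattice_fail -leqNgt.
Qed.

(** At [r = size la] all rows have been read, and the lattice condition concerns the full
    content. *)
Lemma lattice_tableau_anti i :
  (row al i.+1 + weight T i.+1 <= row al i + weight T i)%N.
Proof.
have := lattice_tableauP (size la) i.
have gt_v := gt_of_ssyt lattice_tableau_ssyt.
rewrite !(psum_stable _ gt_v (leqnSn _)) !psum_weight; lia.
Qed.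

Definition lr_shape := intpart_of N (fun i => row al i + weight T i)%N.

Lemma row_lr_shape : (size al <= N)%N ->
  forall i, row lr_shape i = (row al i + weight T i)%N.
Proof.
move=> al_le; apply: row_intpart_of => i; first exact: lattice_tableau_anti.
by move=> leN; rewrite weight_default // row_default //; lia.
Qed.

Lemma size_lr_shape : (size al <= N)%N -> (size lr_shape <= N)%N.
Proof.
by move=> al_le; rewrite size_le_row row_lr_shape // weight_default // row_default.
Qed.

End LatticeTableau.

Definition lr_number (N : nat) (al be la : intpart) : nat :=
  #|[set T : {ffun cell be -> 'I_N} |
      lattice_tableau al T && `[< forall i, row la i = (row al i + weight T i)%N >]]|.

Lemma lr_number_gt0 N al be la : (0 < lr_number N al be la)%N ->
  exists T : {ffun cell be -> 'I_N}, lattice_tableau al T /\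
    forall i, row la i = (row al i + weight T i)%N.
Proof.
by case/card_gt0P => T; rewrite inE => /andP[lat /asboolP e]; exists T.
Qed.

Lemma lr_number_row N al be la i : (0 < lr_number N al be la)%N ->
  (row al i <= row la i)%N.
Proof. by case/lr_number_gt0 => T [_ ->]; exact: leq_addr. Qed.

Lemma row_le_size (al la : intpart) : (forall i, (row al i <= row la i)%N) ->
  (size al <= size la)%N.
Proof.
move=> h; rewrite size_le_row -leqn0.
by rewrite -[X in (_ <= X)%N](row_default (leqnn (size la))).
Qed.

(** An entry [i >= M] would make row [i] of [la] nonempty, so all entries already lie below [M]. *)
Lemma lr_number_widen M N (al be la : intpart) : (M <= N)%N -> (size la <= M)%N ->
  lr_number N al be la = lr_number M al be la.
Proof.
move=> leMN la_le.
pose widen (T : {ffun cell be -> 'I_M}) : {ffun cell be -> 'I_N} :=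
  [ffun c => widen_ord leMN (T c)].
have pat T : pattern (widen T) = pattern T.
  by apply/funext => k; apply/funext => j; apply: eq_card => c; rewrite !inE ffunE.
have wt T : weight (widen T) = weight T.
  by apply/funext => i; apply: eq_card => c; rewrite !inE ffunE.
have ss T : is_ssyt (widen T) = is_ssyt T.
  by apply: eq_forallb => c; apply: eq_forallb => d; rewrite !ffunE.
have lat T : lattice_tableau al (widen T) = lattice_tableau al T.
  by rewrite /lattice_tableau pat ss.
have widen_inj : injective widen.
  move=> T T' /ffunP e; apply/ffunP => c; apply/val_inj.
  by have := congr1 val (e c); rewrite !ffunE.
rewrite /lr_number -(card_imset _ widen_inj); apply: eq_card => T; rewrite !inE.
apply/andP/imsetP => [[latT /asboolP e]|[T' + ->]]; last first.
  by rewrite inE => /andP[lat' e']; rewrite lat wt.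
have T_lt c : (T c < M)%N.
  rewrite ltnNge; apply/negP => leM.
  have : weight T (T c) = 0%N.
    by have := e (T c); rewrite row_default; lia.
  by move/card0_eq/(_ c); rewrite !inE eqxx.
have eT : T = widen [ffun c => Ordinal (T_lt c)].
  by apply/ffunP => c; rewrite !ffunE; apply/val_inj.
exists [ffun c => Ordinal (T_lt c)] => //.
by rewrite inE -lat -wt -eT latT; apply/asboolP.
Qed.

Lemma lr_numberE N (al be la : intpart) (T : {ffun cell be -> 'I_N}) :
    (size al <= N)%N -> (size la <= N)%N ->
  lattice_tableau al T && `[< forall i, row la i = (row al i + weight T i)%N >]
  = lattice_tableau al T && (lr_shape al T == la).
Proof.
move=> al_le la_le; have [lat_T|//] := boolP (lattice_tableau al T) => /=.
apply/asboolP/eqP => [e|<- i]; last by rewrite row_lr_shape.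
by apply: eq_row => i; rewrite row_lr_shape.
Qed.

(** * The bialternant formula and the expansion of products *)

Section SchurExpansion.

Let rho (N : nat) : {mpoly int[N]} :=
  alternate 'X_[expo N (shifted N (fun i => row intpart_nil i))].

(** Row [k] can contain only the entry [k]: if each row [i] above it contains only [i], an entry
    [j.+1 > k] in row [k] would be read before any entry [j]. *)
Lemma lattice_nil N la (T : {ffun cell la -> 'I_N}) :
  lattice_tableau intpart_nil T ->
  forall k j, pattern T k j = if (k < j)%N then row la k else 0%N.
Proof.
move=> lat_T; have gt_v := gt_of_ssyt (lattice_tableau_ssyt lat_T).
have step k : forall j, (k < j)%N -> pattern T k j.+1 = pattern T k j.
  elim/ltn_ind: k => k IH [//|j]; rewrite ltnS => lekj.
  have := lattice_tableauP lat_T k j; rewrite !intpart_nil_row !psumS.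
  have -> : psum (pattern T) k j.+2 = psum (pattern T) k j.+1.
    by apply: eq_bigr => i _; apply: IH => //; have := ltn_ord i; lia.
  have -> : psum (pattern T) k j.+1 = psum (pattern T) k j.
    by apply: eq_bigr => i _; apply: IH => //; have := ltn_ord i; lia.
  by have := gt_incr gt_v k j.+1; lia.
move=> k j; case: ltnP => [ltkj|]; last exact: gt_diag gt_v _ _.
have st d : pattern T k (d + j) = pattern T k j.
  by elim: d => // d IH; rewrite addSn step //; lia.
by rewrite -(st N) (gt_shape gt_v) ?leq_addr.
Qed.

(** This is the bialternant formula cleared of its denominator. It is the product rule for the empty
    partition, where the tableau with constant rows [k] alone survives. *)
Lemma alternant_schur N (la : intpart) : (size la <= N)%N ->
  rho N * schur N la = alternate 'X_[expo N (shifted N (fun i => row la i))].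
Proof.
move=> la_le; rewrite /rho alternate_mul_schur //.
pose v k j := if (k < j)%N then row la k else 0%N.
have gt_v : gt_pattern N la v.
  split=> [k|k j|k j|k j leN]; rewrite /v ?ltn0 //.
  - by case: ltnP => // h; rewrite (leqW h).
  - by rewrite ltnS; case: ifP => // _; exact: row_anti.
  - by case: ltnP => // h; rewrite row_default //; lia.
have [T [ssT eT]] := ssyt_of_gt gt_v.
have psum_v i j : psum v i j.+1 = (psum v i j + if (j < i)%N then row la j else 0)%N.
  elim: i => [|i IH]; first by rewrite !psum0.
  rewrite !psumS IH /v; have [->|ne] := eqVneq i j.
    by rewrite !ltnS leqnn ltnn; lia.
  by do ?case: ifP; lia.
have latT : lattice_tableau intpart_nil T.
  rewrite /lattice_tableau ssT; apply/asboolP => r j.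
  rewrite /lattice_fail !intpart_nil_row !(eq_psum2 _ _ eT) -leqNgt !psum_v.
  by have := row_anti la (leqnSn j); do ?case: ifP; lia.
rewrite (bigD1 T) //= big1 ?addr0 => [|T' /andP[latT' /eqP nT]]; last first.
  case: nT; apply: pattern_inj => // [|k j]; first exact: lattice_tableau_ssyt latT'.
  by rewrite (lattice_nil latT') eT.
congr (alternate 'X_[_]); apply/mnmP => i; rewrite !mnmE /shifted; congr (_ + _)%N.
rewrite intpart_nil_row add0n; have := psum_weight T i.
rewrite !(eq_psum2 _ _ eT) psum_v => /addnI <-.
by case: ltnP => // /row_default->.
Qed.

Lemma rho_neq0 N : rho N != 0.
Proof.
apply/eqP => /(congr1 (mcoeff (expo N (shifted N (fun i => row intpart_nil i))))).
rewrite alternate_coeff => [|i|i]; try exact: row_anti.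
by rewrite mcoeff0 (_ : [forall _, _]) //; apply/forallP => i; rewrite eqxx.
Qed.

(** Multiplied by the nonzero alternant [rho N], both sides become the same sum of alternants, and
    polynomials over the integers form a domain. *)
Lemma schur_mul N (al be : intpart) : (size al <= N)%N ->
  schur N al * schur N be =
  \sum_(T : {ffun cell be -> 'I_N} | lattice_tableau al T) schur N (lr_shape al T).
Proof.
move=> al_le; apply: (mulfI (rho_neq0 N)).
rewrite mulrA alternant_schur // alternate_mul_schur // mulr_sumr.
apply: eq_bigr => T latT; rewrite alternant_schur ?size_lr_shape //.
congr (alternate 'X_[_]); apply/mnmP => i; rewrite !mnmE /shifted.
by rewrite row_lr_shape.
Qed.

(** In [size la] variables, multiplication by [rho] turns each Schur polynomial into an alternant or
    0, and only that of [la] contains this exponent. An expansion is therefore unique. *)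
Lemma schur_expansion_coef f c la : schur_expansion f c ->
  c la = (rho (size la) * f (size la))@_(expo _ (shifted (size la) (fun i => row la i))).
Proof.
case=> fin_c fE; rewrite {}fE.
set N := size la; pose X := fset_set [set mu | c mu != 0]%classic.
have out mu : mu \notin X -> c mu = 0.
  by apply: contraNeq => nz; rewrite in_fset_set ?inE.
rewrite (fsbigTE X) => [|mu /out->]; last by rewrite scale0r.
rewrite mulr_sumr raddf_sum /=.
have coef mu : (rho N * (c mu *: schur N mu))@_(expo N (shifted N (fun i => row la i)))
    = if mu == la then c la else 0.
  rewrite -scalerAr mcoeffZ; have [le_mu|gt_mu] := leqP (size mu) N; last first.
    rewrite schur_eq0 // mulr0 mcoeff0 mulr0; case: eqP => // e.
    by rewrite e ltnn in gt_mu.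
  rewrite alternant_schur // alternate_coeff => [|i|i]; try exact: row_anti.
  case: eqP => [->|ne].
    by rewrite (_ : [forall _, _]) ?mulr1 //; apply/forallP => i; rewrite eqxx.
  case: forallP => [h|]; last by rewrite mulr0.
  case: ne; apply: eq_row => i; have [lti|gei] := ltnP i N.
    exact/eqP/(h (Ordinal lti)).
  by rewrite !row_default //; lia.
rewrite (eq_bigr _ (fun mu _ => coef mu)) -big_mkcond /=.
have [la_X|/[dup] la_X /out ->] := boolP (la \in X); last first.
  by rewrite big1_seq // => mu.
rewrite -big_filter filter_pred1_uniq ?fset_uniq // big_seq1 //.
Qed.

Lemma finite_bounded_intparts n B :
  finite_set [set la : intpart | (size la <= n)%N /\ forall i, (row la i <= B)%N]%classic.
Proof.
pose g (f : {ffun 'I_n -> 'I_B.+1}) := intpart_of n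
  (fun i => if insub i is Some j then f j : nat else 0%N).
apply: (@sub_finite_set _ _ (g @` [set` {: {ffun 'I_n -> 'I_B.+1}}])%classic); last first.
  exact/finite_image/finite_finpred.
move=> la /= [la_n la_B].
exists [ffun i : 'I_n => inord (row la i)] => //.
have e i : (if insub i is Some j then [ffun i : 'I_n => inord (n' := B) (row la i)] j : nat
   else 0%N) = row la i.
  case: insubP => [j _ <-|]; first by rewrite ffunE inordK // ltnS.
  by rewrite -leqNgt => ?; rewrite row_default //; lia.
apply: eq_row => i; rewrite row_intpart_of ?e // => j; rewrite ?e; first exact: row_anti.
by move=> ?; rewrite row_default //; lia.
Qed.

(** Each row of [la] beyond [size al] accounts for at least one cell of [be]. *)
Lemma lattice_size_bound N (al be la : intpart) (T : {ffun cell be -> 'I_N}) :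
    lattice_tableau al T -> (forall i, row la i = (row al i + weight T i)%N) ->
  (size la <= size al + #|cell be|)%N.
Proof.
move=> latT e.
have big d : (size al + d <= size la -> d <= psum (pattern T) (size be) (size al + d))%N.
  elim: d => // d IH le_d; rewrite addnS psum_weight.
  have := e (size al + d)%N; rewrite [row al _]row_default ?leq_addr // add0n => <-.
  have : (0 < row la (size al + d))%N by rewrite row_gt0; lia.
  by have := IH ltac:(lia); lia.
have [|lt_la] := leqP (size la) (size al); first by lia.
have := big (size la - size al)%N ltac:(lia).
rewrite psum_pattern => h.
have := leq_trans h (max_card _); lia.
Qed.

Lemma lr_expansion al be :
  schur_expansion (fun N => schur N al * schur N be)
    (fun la => (lr_number (size la) al be la)%:Z).
Proof.
split.
  apply: sub_finite_set (finite_bounded_intparts (size al + #|cell be|) (row al 0 + #|cell be|)).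
  move=> la /=; rewrite eqz_nat -lt0n => /lr_number_gt0[T [latT e]].
  split; first exact: lattice_size_bound latT e.
  by move=> i; rewrite e leq_add ?row_anti ?max_card.
(* With fewer variables than rows of [al] both sides vanish, because a nonzero coefficient forces
   [al] to be contained in [la]. *)
move=> N; have [al_le|al_gt] := leqP (size al) N; last first.
  rewrite (schur_eq0 al_gt) mul0r fsbig1 // => la _.
  have [la_le|la_gt] := leqP (size la) N; last by rewrite schur_eq0 // scaler0.
  case: (posnP (lr_number (size la) al be la)) => [->|/lr_number_row h].
    by rewrite scale0r.
  by have := row_le_size h; lia.
rewrite schur_mul //.
pose X := [fset lr_shape al T | T in [set T : {ffun cell be -> 'I_N} | lattice_tableau al T]]%fset.
have term (la : intpart) : (lr_number (size la) al be la)%:Z *: schur N la =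
    \sum_(T : {ffun cell be -> 'I_N} | lattice_tableau al T && (lr_shape al T == la))
       schur N (lr_shape al T).
  have [la_le|la_gt] := leqP (size la) N; last first.
    rewrite schur_eq0 // scaler0 big1 // => T /andP[_ /eqP->]; exact: schur_eq0.
  rewrite -(lr_number_widen (N := N)) // /lr_number.
  rewrite (eq_bigr (fun=> schur N la)) => [|T /andP[_ /eqP->] //].
  rewrite sumr_const -scaler_nat natz; congr ((_ %:Z) *: _); apply: eq_card => T.
  by rewrite inE lr_numberE.
rewrite (fsbigTE X) => [|la la_X]; last first.
  rewrite term big1 // => T /andP[latT /eqP e].
  case/negP: la_X; apply/imfsetP; exists T; by rewrite ?inE.
rewrite (eq_bigr _ (fun la _ => term la)).
rewrite -(@sum_fiber _ _ _ _ _ X (fun T => lr_shape al T)) ?fset_uniq // => T _ latT.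
by apply/imfsetP; exists T; rewrite ?inE.
Qed.

Lemma schur_coefE f c la : schur_expansion f c -> schur_coef f la = c la.
Proof.
move=> fc; apply: xget_unique; first by exists c.
by move=> _ [c' fc' ->]; rewrite (schur_expansion_coef la fc) (schur_expansion_coef la fc').
Qed.

End SchurExpansion.

Lemma lr_coefE N (al be la : intpart) : (size la <= N)%N ->
  lr_coef al be la = (lr_number N al be la)%:Z.
Proof.
move=> la_le; rewrite (@lr_number_widen (size la) N) // /lr_coef.
by rewrite (schur_coefE _ (lr_expansion al be)).
Qed.

(** The triangle of [nu] presents its edges in the order [ga], [al], opposite to that in
    [nl_coef]. *)
Lemma lr_coefC al be la : lr_coef al be la = lr_coef be al la.
Proof.
have [fin e] := lr_expansion al be.
rewrite [LHS](schur_coefE _ (conj fin e)); apply/esym.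
apply: (@schur_coefE _ (fun la => (lr_number (size la) al be la)%:Z)).
by split=> // N; rewrite -e mulrC.
Qed.

(** * Hives of a triangle *)

Lemma intpart_ofK n (al : intpart) f : (size al <= n)%N ->
  (forall k, (k < n)%N -> f k = row al k) -> intpart_of n f = al.
Proof.
move=> al_le e; have -> : intpart_of n f = intpart_of n (fun k => row al k).
  rewrite /intpart_of (_ : mkseq f n = mkseq (fun k => row al k) n) //.
  by apply/eq_in_map => k; rewrite mem_iota => /e.
apply: eq_row; apply: row_intpart_of => i; first exact: row_anti.
by move=> le_i; rewrite row_default //; exact: leq_trans le_i.
Qed.

Lemma psum_diag N la v i j : gt_pattern N la v -> (j <= i)%N -> psum v i j = psum v j j.
Proof.
move=> gt_v /subnK <-; elim: (i - j)%N => //= d IH.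
by rewrite addSn psumS IH (gt_diag gt_v) ?addn0 // leq_addl.
Qed.

Lemma psum_total N la v j : gt_pattern N la v -> psum v (size la) j = psum v j j.
Proof.
move=> gt_v; rewrite -(psum_stable j gt_v (leq_maxl (size la) j)).
exact: psum_diag gt_v (leq_maxr _ _).
Qed.

(* The left, right and bottom edges of the triangle [0 <= i <= j <= n] are
   labelled by [x], [y] and [z]; the upside-down triangle of a composite hive
   becomes such a triangle by exchanging its two coordinates. *)
Record triangle_hive (n : nat) (x y z : intpart) (h : nat -> nat -> int) : Prop :=
  TriangleHive {
    hive_left : forall j, (j < n)%N -> h 0%N j.+1 - h 0%N j = (row x j)%:Z;
    hive_right : forall i, (i < n)%N -> h i.+1 n - h i n = (row y i)%:Z;
    hive_bottom : forall i, (i < n)%N -> h i.+1 i.+1 - h i i = (row z i)%:Z;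
    hive_rhombus1 : forall i j, (i <= j)%N -> (j.+2 <= n)%N ->
      h i.+1 j.+2 + h i j <= h i j.+1 + h i.+1 j.+1;
    hive_rhombus2 : forall i j, (i < j < n)%N ->
      h i j.+1 + h i.+1 j <= h i j + h i.+1 j.+1;
    hive_rhombus3 : forall i j, (i < j < n)%N ->
      h i j + h i.+2 j.+1 <= h i.+1 j + h i.+1 j.+1 }.

Definition hive_of_tableau N (x y : intpart) (T : {ffun cell y -> 'I_N}) (i j : nat) : int :=
  (\sum_(k < j) row x k + psum (pattern T) i j)%N%:Z.

(** All conditions concern differences of labels, so a constant may be added; inside a composite
    hive a triangle need not start at 0. *)
Lemma eq_triangle_hive n x y z h h' (c : int) :
  (forall i j, (i <= j <= n)%N -> h i j = c + h' i j) ->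
  triangle_hive n x y z h' -> triangle_hive n x y z h.
Proof.
move=> e [hl hr hb h1 h2 h3]; split=> [j ltj|i lti|i lti|i j le1 le2|i j lts|i j lts].
- by have := hl j ltj; rewrite !e; lia.
- by have := hr i lti; rewrite !e; lia.
- by have := hb i lti; rewrite !e; lia.
- by have := h1 i j le1 le2; rewrite !e; lia.
- by have := h2 i j lts; rewrite !e; lia.
- by have := h3 i j lts; rewrite !e; lia.
Qed.

Section TriangleHive.
Variables (n : nat) (x y z : intpart).
Implicit Type T : {ffun cell y -> 'I_n}.

(** The first rhombus family is the lattice condition, the second the growth of the pattern along
    rows, the third the interlacing. The right edge is the shape and the bottom edge is [x] plus the
    content. *)
Lemma hive_of_tableauP T : lattice_tableau x T ->
    (forall i, row z i = (row x i + weight T i)%N) ->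
  triangle_hive n x y z (hive_of_tableau x T).
Proof.
move=> latT e; have gt_v := gt_of_ssyt (lattice_tableau_ssyt latT).
rewrite /hive_of_tableau; split=> [j _|i lti|i lti|i j le1 le2|i j|i j].
- by rewrite !psum0 big_ord_recr /=; lia.
- by rewrite psumS (gt_shape gt_v i (leqnn n)); lia.
- have := psum_weight T i; rewrite !(psum_total _ gt_v) e big_ord_recr /=; lia.
- by have := lattice_tableauP latT i j; rewrite !big_ord_recr /=; lia.
- rewrite !psumS !big_ord_recr /= => _; have := gt_incr gt_v i j; lia.
- rewrite !psumS !big_ord_recr /= => _; have := gt_interlace gt_v i j; lia.
Qed.

(** The labels determine [pattern T k j] for [k < j < n]; elsewhere it is 0 or a part of [y]. *)
Lemma hive_of_tableau_inj T T' : is_ssyt T -> is_ssyt T' ->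
    (forall i j, (i <= j <= n)%N -> hive_of_tableau x T i j = hive_of_tableau x T' i j) ->
  T = T'.
Proof.
move=> ssT ssT' e; have gt_v := gt_of_ssyt ssT; have gt_v' := gt_of_ssyt ssT'.
apply: pattern_inj => // k j.
have [lenj|ltjn] := leqP n j; first by rewrite (gt_shape gt_v) ?(gt_shape gt_v').
have [lejk|ltkj] := leqP j k; first by rewrite (gt_diag gt_v) ?(gt_diag gt_v').
have := e k j; have := e k.+1 j; rewrite /hive_of_tableau !psumS.
by lia.
Qed.

Lemma tableau_of_hive h : triangle_hive n x y z h ->
    (size x <= n)%N -> (size y <= n)%N -> (size z <= n)%N ->
  exists T, [/\ lattice_tableau x T,
    forall i, row z i = (row x i + weight T i)%N
  & forall i j, (i <= j <= n)%N -> h i j = h 0%N 0%N + hive_of_tableau x T i j].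
Proof.
move=> [hl hr hb h1 h2 h3] x_le y_le z_le.
(* By the third rhombus family these differences only decrease from [(k, j)] to [(k.+1, j.+1)], and
   on the right edge they are parts of [y]. *)
have d_ge0 k j : (k < j <= n)%N -> 0 <= h k.+1 j - h k j.
  move=> /andP[ltkj lejn]; move: (leqnn (n - j)).
  move: {2}(n - j)%N => d; elim: d => [|d IH] in k j ltkj lejn *.
    by move=> ?; have -> : j = n by [lia]; rewrite hr; lia.
  move=> led; have [ej|nj] := eqVneq j n; first by subst j; rewrite hr; lia.
  by have := IH k.+1 j.+1; have := h3 k j; lia.
pose v k j := if (n <= j)%N then row y k
  else if (k < j)%N then `|h k.+1 j - h k j|%N else 0%N.
have vE k j : (k < j <= n)%N -> (v k j)%:Z = h k.+1 j - h k j.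
  move=> kj; rewrite /v; case: ifP => [lenj|_].
    by have -> : j = n by [lia]; rewrite hr //; lia.
  by have := d_ge0 k j kj; case: ifP; lia.
have v_diag k j : (j <= k)%N -> v k j = 0%N.
  move=> lejk; rewrite /v; case: ifP => [lenj|_]; last by case: ifP => //; lia.
  by rewrite row_default //; lia.
have gt_v : gt_pattern n y v.
  split=> [k|k j|k j|k j lenj]; last by rewrite /v lenj.
  - exact: v_diag.
  - have [lejk|ltkj] := leqP j k; first by rewrite v_diag.
    have [lenj|ltjn] := leqP n j; first by rewrite /v lenj leqW.
    have := vE k j; have := vE k j.+1; have := h2 k j; lia.
  - have [lejk|ltkj] := leqP j k; first by rewrite [v k.+1 _]v_diag.
    have [lenj|ltjn] := leqP n j; first by rewrite /v lenj leqW // row_anti.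
    have := vE k j; have := vE k.+1 j.+1; have := h3 k j; lia.
have [T [ssT eT]] := ssyt_of_gt gt_v.
have psum_h i j : (i <= j <= n)%N -> (psum v i j)%:Z = h i j - h 0%N j.
  elim: i => [|i IH] ij; first by rewrite psum0 subrr.
  by rewrite psumS PoszD IH ?vE; lia.
have sum_h j : (j <= n)%N -> (\sum_(k < j) row x k)%N%:Z = h 0%N j - h 0%N 0%N.
  elim: j => [|j IH] lej; first by rewrite big_ord0 subrr.
  by rewrite big_ord_recr PoszD IH /= -?hl; lia.
have eh i j : (i <= j <= n)%N -> h i j = h 0%N 0%N + hive_of_tableau x T i j.
  move=> ij; rewrite /hive_of_tableau PoszD (eq_psum2 _ _ eT) psum_h // sum_h; lia.
exists T; split=> // [|i].
  rewrite /lattice_tableau ssT; apply/asboolP => r j.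
  rewrite (eq_lattice_fail _ _ _ eT).
  have [lejn|ltnj] := leqP j.+2 n; last first.
    by apply/negP => /(lattice_fail_lt x_le gt_v); lia.
  have low i : (i <= j)%N -> ~~ lattice_fail x v i j.
    move=> leij; rewrite /lattice_fail.
    have := h1 i j leij lejn; have := hl j; have := psum_h i j; have := psum_h i j.+1.
    by have := psum_h i.+1 j.+1; have := psum_h i.+1 j.+2; have := hl j.+1; lia.
  (* Rhombi of the triangle only cover [r <= j]. For larger [r] the sums stop at the diagonal, and
     the inequality follows from the case [r = j] and one interlacing. *)
  have [/low//|ltjr] := leqP r j.
  have := low j (leqnn j); rewrite /lattice_fail.
  rewrite (psum_diag gt_v (i := r) (j := j.+1)) //.
  rewrite (psum_diag gt_v (i := r.+1) (j := j.+1)); last by lia.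
  rewrite (psum_diag gt_v (i := r.+1) (j := j.+2)) //.
  rewrite (psum_diag gt_v (i := r) (j := j)); last by lia.
  rewrite psumS [psum v j.+2 _]psumS; have := gt_interlace gt_v j j.+1; lia.
have [lein|ltin] := leqP n i; first by rewrite weight_default // !row_default //; lia.
have := hb i ltin; have := hl i ltin; have := psum_h i i; have := psum_h i.+1 i.+1.
have := psum_weight T i; rewrite !(eq_psum2 _ _ eT) !(psum_total _ gt_v).
by lia.
Qed.

End TriangleHive.

(** * Labellings of the trapezoid *)

Section Labels.
Variable n : nat.
Implicit Type a : labelling n.

Definition labelling_of (f : nat -> nat -> int) : labelling n :=
  [ffun v : vertex n => f (val v).1 (val v).2].

Lemma label_vertex a (v : vertex n) : label a (val v).1 (val v).2 = a v.
Proof.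
rewrite /label; case: pickP => [w /andP[/eqP e1 /eqP e2]|/(_ v)]; last by rewrite !eqxx.
congr (a _); apply/val_inj; rewrite (surjective_pairing (val w)) (surjective_pairing (val v)).
by congr pair; apply/val_inj.
Qed.

Lemma vertex_exists i j : in_trapezoid n i j ->
  exists v : vertex n, (val v).1 = i :> nat /\ (val v).2 = j :> nat.
Proof.
move=> tij; have lti : (i < (2 * n).+1)%N by move: tij; rewrite /in_trapezoid; lia.
have ltj : (j < (2 * n).+1)%N by move: tij; rewrite /in_trapezoid; lia.
by exists (Sub (Ordinal lti, Ordinal ltj) tij).
Qed.

Lemma label_of f i j : in_trapezoid n i j -> label (labelling_of f) i j = f i j.
Proof.
by move=> /vertex_exists[v [<- <-]]; rewrite label_vertex ffunE.
Qed.

Lemma label_inj a b :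
  (forall i j, in_trapezoid n i j -> label a i j = label b i j) -> a = b.
Proof.
by move=> e; apply/ffunP => v; rewrite -!label_vertex e //; exact: (valP v).
Qed.

End Labels.

(** * Cutting a composite hive into three triangles *)

Section CompositeHives.
Variables (n : nat) (mu nu la : intpart).
Implicit Type a : labelling n.

Definition composite_triangles (al be ga : intpart) (h : nat -> nat -> int) : Prop :=
  [/\ triangle_hive n al be mu h,
      triangle_hive n ga al nu (fun i j => h (n + i)%N (n + j)%N)
    & triangle_hive n be ga la (fun k i => h i (n + k)%N)].

(** Exchanging the coordinates in the triangle of [la] swaps the first and third rhombus families.
    The matching condition holds because [al] labels both outer slanted edges. *)
Lemma composite_hive_of_triangles (al be ga : intpart) a :
    composite_triangles al be ga (label a) -> label a 0 0 = 0 ->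
  composite_hive mu nu la a.
Proof.
move=> [Hm Hn Hl] a0; split=> //.
- move=> [//|i] /= ltin; split.
  + by have := hive_bottom Hm ltin.
  + by rewrite addnS; have := hive_bottom Hn ltin; rewrite addnS.
  + by rewrite addnS; have := hive_bottom Hl ltin; rewrite addnS.
- move=> i j; split; rewrite /rhombus /same_triangle /in_tri_mu /in_tri_nu /in_tri_la /=.
  + case/or3P => hin.
    * by have := hive_rhombus1 Hm (i := i) (j := j); lia.
    * have -> : i = (n + (i - n))%N by lia.
      have -> : j = (n + (j - n))%N by lia.
      by have := hive_rhombus1 Hn (i := i - n) (j := j - n); rewrite !addnS; lia.
    * have -> : j = (n + (j - n))%N by lia.
      by have := hive_rhombus3 Hl (i := j - n) (j := i); rewrite !addnS; lia.
  + case/or3P => hin.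
    * by have := hive_rhombus2 Hm (i := i) (j := j); lia.
    * have -> : i = (n + (i - n))%N by lia.
      have -> : j = (n + (j - n))%N by lia.
      by have := hive_rhombus2 Hn (i := i - n) (j := j - n); rewrite !addnS; lia.
    * have -> : j = (n + (j - n))%N by lia.
      by have := hive_rhombus2 Hl (i := j - n) (j := i); rewrite !addnS; lia.
  + case/or3P => hin.
    * by have := hive_rhombus3 Hm (i := i) (j := j); lia.
    * have -> : i = (n + (i - n))%N by lia.
      have -> : j = (n + (j - n))%N by lia.
      by have := hive_rhombus3 Hn (i := i - n) (j := j - n); rewrite !addnS; lia.
    * have -> : j = (n + (j - n))%N by lia.
      by have := hive_rhombus1 Hl (i := j - n) (j := i); rewrite !addnS; lia.
- move=> [//|j] /= ltjn; rewrite addnS /=.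
  have := hive_left Hm ltjn; have := hive_right Hn ltjn.
  by rewrite addnS mul2n -addnn => -> ->.
- split; split=> [[//|j] lt|[//|j] lt]; rewrite ?addnS /=.
  + by rewrite !(hive_left Hm) ?lez_nat ?row_anti //; lia.
  + by rewrite !(hive_left Hm) //; lia.
  + by rewrite !(hive_right Hm) ?lez_nat ?row_anti //; lia.
  + by rewrite !(hive_right Hm) //; lia.
  + have := hive_left Hn (j := j); have := hive_left Hn (j := j.+1).
    rewrite !addnS !addn0; have := row_anti ga (leqnSn j); lia.
  + by have := hive_left Hn (j := j); rewrite !addnS !addn0; lia.
Qed.

Definition boundary_intpart (f : nat -> int) : intpart :=
  intpart_of n (fun k => `|f k.+1 - f k|%N).

Lemma boundary_intpartP f : partition_seq n (fun j => f j - f j.-1) ->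
  (size (boundary_intpart f) <= n)%N /\
  forall k, (k < n)%N -> (row (boundary_intpart f) k)%:Z = f k.+1 - f k.
Proof.
move=> [f_anti f_ge0].
(* Cut off at [n], the increments decrease everywhere and end in zeros, as [row_intpart_of]
   requires. *)
pose g k := if (k < n)%N then `|f k.+1 - f k|%N else 0%N.
have -> : boundary_intpart f = intpart_of n g.
  rewrite /boundary_intpart /intpart_of; congr (insubd _ _); congr (filter _ _).
  by apply/eq_in_map => k; rewrite mem_iota /g => /andP[_ ->].
have rowE : forall i, row (intpart_of n g) i = g i.
  apply: row_intpart_of => i; last by rewrite /g ltnNge => ->.
  have := f_ge0 i.+1; have := f_ge0 i.+2; have := f_anti i.+1; rewrite /g /=.
  by do ?case: ifP; lia.
split=> [|k ltk]; first by rewrite size_le_row rowE /g ltnn.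
by rewrite rowE /g ltk; have := f_ge0 k.+1; rewrite /=; lia.
Qed.

Definition inner_intparts a : intpart * intpart * intpart :=
  (boundary_intpart (fun j => label a 0 j), boundary_intpart (fun j => label a j n),
   boundary_intpart (fun j => label a n (n + j))).

Lemma boundary_intpartK f (x : intpart) : (size x <= n)%N ->
  (forall k, (k < n)%N -> f k.+1 - f k = (row x k)%:Z) -> boundary_intpart f = x.
Proof. by move=> x_le e; apply: intpart_ofK => // k ltk; rewrite e. Qed.

Lemma inner_intpartsK (al be ga : intpart) a : (size al <= n)%N -> (size be <= n)%N ->
    (size ga <= n)%N -> composite_triangles al be ga (label a) ->
  inner_intparts a = (al, be, ga).
Proof.
move=> al_le be_le ga_le [Hm Hn _]; congr (_, _, _); apply: boundary_intpartK => // k ltk.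
- by have := hive_left Hm ltk.
- by have := hive_right Hm ltk.
- by have := hive_left Hn ltk; rewrite addn0.
Qed.

Lemma triangles_of_composite_hive a : composite_hive mu nu la a ->
  exists al be ga : intpart, [/\ (size al <= n)%N, (size be <= n)%N, (size ga <= n)%N
    & composite_triangles al be ga (label a)].
Proof.
move=> [a0 bd rh mt [in1 in2 in3]].
have in3' : partition_seq n (fun j => label a n (n + j) - label a n (n + j.-1)).
  by case: in3 => h1 h2; split=> [[//|j] /h1|[//|j] /h2]; rewrite !addnS.
have [al_le alE] := boundary_intpartP in1.
have [be_le beE] := boundary_intpartP in2.
have [ga_le gaE] := boundary_intpartP (f := fun j => label a n (n + j)) in3'.
set al := boundary_intpart _ in al_le alE; set be := boundary_intpart _ in be_le beE.
set ga := boundary_intpart _ in ga_le gaE.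
exists al, be, ga; split=> //.
have rhE i j := rh i j.
rewrite /rhombus /same_triangle /in_tri_mu /in_tri_nu /in_tri_la /= in rhE.
split; split.
- by move=> j ltj; rewrite alE.
- by move=> i lti; rewrite beE.
- by move=> i lti; have [] := bd i.+1 lti.
- by move=> i j le1 le2; have [r1 _ _] := rhE i j; apply: r1; lia.
- by move=> i j lts; have [_ r2 _] := rhE i j; apply: r2; lia.
- by move=> i j lts; have [_ _ r3] := rhE i j; apply: r3; lia.
- by move=> j ltj; rewrite addn0 gaE.
- move=> i lti; have := mt i.+1 lti; rewrite mul2n -addnn !addnS /= => <-.
  by rewrite alE.
- by move=> i lti; have [_ + _] := bd i.+1 lti; rewrite !addnS.
- by move=> i j le1 le2; rewrite !addnS; have [r1 _ _] := rhE (n + i)%N (n + j)%N; apply: r1; lia.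
- by move=> i j lts; rewrite !addnS; have [_ r2 _] := rhE (n + i)%N (n + j)%N; apply: r2; lia.
- by move=> i j lts; rewrite !addnS; have [_ _ r3] := rhE (n + i)%N (n + j)%N; apply: r3; lia.
- by move=> j ltj; rewrite addn0 beE.
- by move=> i lti; rewrite gaE.
- by move=> i lti; have [_ _] := bd i.+1 lti; rewrite !addnS.
- move=> i j le1 le2; rewrite !addnS; have [_ _ r3] := rhE j (n + i)%N.
  by rewrite [X in _ <= X]addrC [X in X <= _]addrC; lia.
- move=> i j lts; rewrite !addnS; have [_ r2 _] := rhE j (n + i)%N; lia.
- move=> i j lts; rewrite !addnS; have [r1 _ _] := rhE j (n + i)%N; lia.
Qed.

End CompositeHives.

(** * Composite hives *)

Section Gluing.
Variables (n : nat) (mu nu la : intpart).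
Hypotheses (mu_le : (size mu <= n)%N) (nu_le : (size nu <= n)%N).
Hypothesis la_le : (size la <= n)%N.

Definition lr_tableaux (al be ka : intpart) : {set {ffun cell be -> 'I_n}} :=
  [set T | lattice_tableau al T &&
     `[< forall i, row ka i = (row al i + weight T i)%N >]].

Lemma lr_tableauxP al be ka T : reflect
  (lattice_tableau al T /\ forall i, row ka i = (row al i + weight T i)%N)
  (T \in lr_tableaux al be ka).
Proof. by rewrite inE; apply: (iffP andP) => -[? /asboolP]. Qed.

Section FixedInner.
Variables al be ga : intpart.
(** The added constants are the labels that the first triangle gives to the corners [(0, n)] and
    [(n, n)], where the other two triangles start. *)
Definition glue (T1 : {ffun cell be -> 'I_n}) (T2 : {ffun cell al -> 'I_n})
    (T3 : {ffun cell ga -> 'I_n}) : labelling n := labelling_of n (fun i j =>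
  if (j <= n)%N then hive_of_tableau al T1 i j
  else if (i < n)%N then hive_of_tableau al T1 0 n + hive_of_tableau be T3 (j - n) i
  else hive_of_tableau al T1 n n + hive_of_tableau ga T2 (i - n) (j - n)).

Lemma glue_mu T1 T2 T3 i j : (i <= j <= n)%N ->
  label (glue T1 T2 T3) i j = hive_of_tableau al T1 i j.
Proof.
move=> ij; rewrite label_of; first by rewrite (_ : (j <= n)%N) //; lia.
by rewrite /in_trapezoid; lia.
Qed.

Lemma glue_nu T1 T2 T3 i j : (i <= j <= n)%N ->
  label (glue T1 T2 T3) (n + i) (n + j)
  = hive_of_tableau al T1 n n + hive_of_tableau ga T2 i j.
Proof.
move=> ij; rewrite label_of; last by rewrite /in_trapezoid; lia.
have [lej|ltj] := leqP (n + j) n.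
  have [-> ->] : i = 0%N /\ j = 0%N by lia.
  by rewrite !addn0 {3}/hive_of_tableau psum0 big_ord0; lia.
by rewrite ltnNge leq_addr /= !addKn.
Qed.

Lemma glue_la T1 T2 T3 i k : is_ssyt T1 -> is_ssyt T3 -> (k <= i <= n)%N ->
  label (glue T1 T2 T3) i (n + k)
  = hive_of_tableau al T1 0 n + hive_of_tableau be T3 k i.
Proof.
move=> /gt_of_ssyt gt1 /gt_of_ssyt gt3 ki; rewrite label_of; last first.
  by rewrite /in_trapezoid; lia.
have right N la' (T : {ffun cell la' -> 'I_N}) m : gt_pattern N la' (pattern T) ->
    psum (pattern T) m N = (\sum_(l < m) row la' l)%N.
  by move=> gt_v; apply: eq_bigr => l _; exact: gt_shape gt_v _ _ (leqnn _).
(* On the two shared edges [glue] uses another tableau; the labels agree because both give partial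
   sums of [be] for [k = 0] and of [ga] for [i = n]. *)
have [lej|ltj] := leqP (n + k) n.
  have -> : k = 0%N by lia.
  by rewrite addn0 /hive_of_tableau !psum0 right //; lia.
case: ltnP => [lti|lei]; first by rewrite addKn.
have -> : i = n by lia.
by rewrite addKn subnn /hive_of_tableau !psum0 !right //; lia.
Qed.

Lemma glue_triangles T1 T2 T3 : T1 \in lr_tableaux al be mu ->
    T2 \in lr_tableaux ga al nu -> T3 \in lr_tableaux be ga la ->
  composite_triangles n mu nu la al be ga (label (glue T1 T2 T3)).
Proof.
move=> /lr_tableauxP[l1 w1] /lr_tableauxP[l2 w2] /lr_tableauxP[l3 w3].
have [s1 s3] := (lattice_tableau_ssyt l1, lattice_tableau_ssyt l3).
split.
- apply: (eq_triangle_hive (c := 0)) (hive_of_tableauP l1 w1) => i j ij.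
  by rewrite glue_mu // add0r.
- apply: eq_triangle_hive (hive_of_tableauP l2 w2) => i j ij; exact: glue_nu.
- apply: eq_triangle_hive (hive_of_tableauP l3 w3) => k i ki; exact: glue_la.
Qed.

Lemma glue_composite T1 T2 T3 : T1 \in lr_tableaux al be mu ->
    T2 \in lr_tableaux ga al nu -> T3 \in lr_tableaux be ga la ->
  composite_hive mu nu la (glue T1 T2 T3).
Proof.
move=> h1 h2 h3; apply: composite_hive_of_triangles (glue_triangles h1 h2 h3) _.
by rewrite glue_mu // /hive_of_tableau psum0 big_ord0.
Qed.

Lemma glue_surj a : composite_hive mu nu la a ->
    (size al <= n)%N -> (size be <= n)%N -> (size ga <= n)%N ->
    composite_triangles n mu nu la al be ga (label a) ->
  exists T1 T2 T3, [/\ T1 \in lr_tableaux al be mu, T2 \in lr_tableaux ga al nu,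
    T3 \in lr_tableaux be ga la & a = glue T1 T2 T3].
Proof.
move=> [a0 _ _ _ _] al_le be_le ga_le [Hm Hn Hl].
have [T1 [l1 w1 e1]] := tableau_of_hive Hm al_le be_le mu_le.
have [T2 [l2 w2 e2]] := tableau_of_hive Hn ga_le al_le nu_le.
have [T3 [l3 w3 e3]] := tableau_of_hive Hl be_le ga_le la_le.
have [s1 s3] := (lattice_tableau_ssyt l1, lattice_tableau_ssyt l3).
exists T1, T2, T3; split; try exact/lr_tableauxP.
apply: label_inj => i j; rewrite /in_trapezoid => tij.
rewrite a0 in e1; rewrite !addn0 in e2 e3.
have [lejn|ltnj] := leqP j n; first by rewrite glue_mu ?e1 ?a0 ?add0r //; lia.
have ej : j = (n + (j - n))%N by lia.
have [lein|ltni] := leqP i n.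
  by rewrite ej glue_la // ?e3 ?e1 ?a0 ?add0r //; lia.
have ei : i = (n + (i - n))%N by lia.
by rewrite ei ej glue_nu // ?e2 ?e1 ?a0 ?add0r //; lia.
Qed.

Lemma glue_inj T1 T2 T3 T1' T2' T3' :
    T1 \in lr_tableaux al be mu -> T2 \in lr_tableaux ga al nu ->
    T3 \in lr_tableaux be ga la -> T1' \in lr_tableaux al be mu ->
    T2' \in lr_tableaux ga al nu -> T3' \in lr_tableaux be ga la ->
  glue T1 T2 T3 = glue T1' T2' T3' -> [/\ T1 = T1', T2 = T2' & T3 = T3'].
Proof.
move=> /lr_tableauxP[/lattice_tableau_ssyt s1 _] /lr_tableauxP[/lattice_tableau_ssyt s2 _].
move=> /lr_tableauxP[/lattice_tableau_ssyt s3 _] /lr_tableauxP[/lattice_tableau_ssyt s1' _].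
move=> /lr_tableauxP[/lattice_tableau_ssyt s2' _] /lr_tableauxP[/lattice_tableau_ssyt s3' _] e.
have e1 : T1 = T1'.
  apply: (@hive_of_tableau_inj _ al) => // i j ij.
  by rewrite -(glue_mu _ T2 T3 ij) e glue_mu.
subst T1'; split=> //.
  apply: (@hive_of_tableau_inj _ ga) => // i j ij.
  by have := glue_nu T1 T2 T3 ij; rewrite e glue_nu // => /addrI.
apply: (@hive_of_tableau_inj _ be) => // k i ki.
by have := glue_la T2 s1 s3 ki; rewrite e glue_la // => /addrI.
Qed.

End FixedInner.

(** * Counting over all triples of inner partitions *)

Definition bounded_intparts : set intpart :=
  [set x : intpart | (size x <= n)%N /\
    forall i, (row x i <= row mu 0 + row nu 0 + row la 0)%N]%classic.

Definition triples : set (intpart * intpart * intpart) :=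
  (bounded_intparts `*` bounded_intparts `*` bounded_intparts)%classic.

Lemma finite_triples : finite_set triples.
Proof.
do 2 (apply: finite_setX; last exact: finite_bounded_intparts).
exact: finite_bounded_intparts.
Qed.

(** Each inner partition is the first index of one factor, hence contained in [mu], [nu] or [la].
    This confines the sum in [nl_coef] to a finite set. *)
Lemma triples_mem al be ga : (0 < lr_number n al be mu)%N ->
    (0 < lr_number n ga al nu)%N -> (0 < lr_number n be ga la)%N ->
  triples (al, be, ga).
Proof.
move=> h1 h2 h3; have r1 i := lr_number_row i h1; have r2 i := lr_number_row i h2.
have r3 i := lr_number_row i h3.
have b1 := @row_anti mu; have b2 := @row_anti nu; have b3 := @row_anti la.
suff [A1 A2 A3] : [/\ bounded_intparts al, bounded_intparts be & bounded_intparts ga].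
  exact: (conj (conj A1 A2) A3).
split; split=> [|i].
- exact: leq_trans (row_le_size r1) mu_le.
- by have := r1 i; have := b1 0%N i isT; lia.
- exact: leq_trans (row_le_size r3) la_le.
- by have := r3 i; have := b3 0%N i isT; lia.
- exact: leq_trans (row_le_size r2) nu_le.
- by have := r2 i; have := b2 0%N i isT; lia.
Qed.

Definition triple_count (p : intpart * intpart * intpart) : nat :=
  let: (al, be, ga) := p in
  (lr_number n al be mu * lr_number n ga al nu * lr_number n be ga la)%N.

Lemma nl_coefE : nl_coef mu nu la = (\sum_(p <- fset_set triples) triple_count p)%N%:Z.
Proof.
have term p : (let: (al, be, ga) := p in
    lr_coef al be mu * lr_coef al ga nu * lr_coef be ga la) = (triple_count p)%:Z.
  case: p => [[al be] ga] /=.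
  by rewrite [lr_coef al ga nu]lr_coefC !(@lr_coefE n) // !PoszM.
rewrite /nl_coef (fsbigTE (fset_set triples)) => [|p out].
  rewrite (eq_bigr _ (fun p _ => term p)) -[RHS]natz natr_sum.
  by apply: eq_bigr => p _; rewrite natz.
rewrite term; apply/eqP; rewrite eqz_nat; apply: contraNT out.
case: p => [[al be] ga]; rewrite -lt0n /= !muln_gt0 => /andP[/andP[h1 h2] h3].
by rewrite in_fset_set ?inE; [exact: triples_mem | exact: finite_triples].
Qed.

Definition glue_triple (al be ga : intpart)
    (T : {ffun cell be -> 'I_n} * {ffun cell al -> 'I_n} * {ffun cell ga -> 'I_n}) :=
  glue T.1.1 T.1.2 T.2.

Lemma composite_hive_glue a : composite_hive mu nu la a ->
  exists al be ga, triples (al, be, ga) /\ exists T1 T2 T3,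
    [/\ T1 \in lr_tableaux al be mu, T2 \in lr_tableaux ga al nu,
        T3 \in lr_tableaux be ga la & a = glue T1 T2 T3].
Proof.
move=> ca; have [al [be [ga [al_le be_le ga_le tri]]]] := triangles_of_composite_hive ca.
have [T1 [T2 [T3 [h1 h2 h3 e]]]] := glue_surj ca al_le be_le ga_le tri.
exists al, be, ga; split; last by exists T1, T2, T3.
by apply: triples_mem; apply/card_gt0P; [exists T1|exists T2|exists T3].
Qed.

Lemma finite_composite_hives : finite_set (composite_hives n mu nu la).
Proof.
pose F p : set (labelling n) := let: (al, be, ga) := p in
  (@glue_triple al be ga @` [set` {: _}])%classic.
apply: (@sub_finite_set _ _ (\bigcup_(p in triples) F p)%classic).
  move=> a /composite_hive_glue[al [be [ga [tri [T1 [T2 [T3 [_ _ _ ->]]]]]]]].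
  by exists (al, be, ga) => //; exists (T1, T2, T3).
apply: bigcup_finite; first exact: finite_triples.
by move=> [[al be] ga] _; apply/finite_image/finite_finpred.
Qed.

(** The hives are grouped by their inner partitions; [glue] maps the triples of lattice tableaux
    bijectively onto each group. *)
Lemma card_composite_hives :
  #|` fset_set (composite_hives n mu nu la)|%fset
  = (\sum_(p <- fset_set triples) triple_count p)%N.
Proof.
have fin := finite_composite_hives.
have glue_key al be ga T1 T2 T3 : triples (al, be, ga) ->
    T1 \in lr_tableaux al be mu -> T2 \in lr_tableaux ga al nu ->
    T3 \in lr_tableaux be ga la ->
    inner_intparts (glue T1 T2 T3 : labelling n) = (al, be, ga).
  move=> [[/= [al_le _] [be_le _]] [ga_le _]] h1 h2 h3.
  exact: inner_intpartsK (glue_triangles h1 h2 h3).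
rewrite card_fset_sum1.
rewrite (@sum_fiber _ _ _ _ xpredT (fset_set triples) (@inner_intparts n)) ?fset_uniq //; last first.
  move=> a; rewrite in_fset_set // inE => /composite_hive_glue.
  move=> [al [be [ga [tri [T1 [T2 [T3 [h1 h2 h3 ->]]]]]]]] _.
  by rewrite (glue_key al be ga) // in_fset_set ?inE //; exact: finite_triples.
apply: eq_big_seq => -[[al be] ga]; rewrite in_fset_set ?inE; last exact: finite_triples.
move=> tri; pose S := finset.setX (finset.setX (lr_tableaux al be mu)
  (lr_tableaux ga al nu)) (lr_tableaux be ga la).
have memS (T1 : {ffun cell be -> 'I_n}) (T2 : {ffun cell al -> 'I_n})
    (T3 : {ffun cell ga -> 'I_n}) :
    (T1, T2, T3) \in S = [&& T1 \in lr_tableaux al be mu, T2 \in lr_tableaux ga al nu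
      & T3 \in lr_tableaux be ga la].
  by rewrite !finset.in_setX -andbA.
pose X := [fset glue_triple T | T in S]%fset.
have -> : triple_count (al, be, ga) = #|` X|.
  rewrite card_in_imfset /= ?size_enum_finmem; first by rewrite -cardE !cardsX.
  move=> [[T1 T2] T3] [[T1' T2'] T3'] /=; rewrite !memS => /and3P[h1 h2 h3].
  by move=> /and3P[h1' h2' h3'] /(glue_inj h1 h2 h3 h1' h2' h3')[-> -> ->].
rewrite -big_filter sum1_size; apply/perm_size/uniq_perm.
- exact/filter_uniq/fset_uniq.
- exact: fset_uniq.
move=> a; rewrite mem_filter in_fset_set //; apply/andP/imfsetP => [[/eqP key]|].
  rewrite inE => /composite_hive_glue[al' [be' [ga' [tri' [T1 [T2 [T3 [h1 h2 h3 ea]]]]]]]].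
  move: key; rewrite ea (glue_key _ _ _ _ _ _ tri' h1 h2 h3) => -[e1 e2 e3].
  subst al' be' ga'; exists (T1, T2, T3) => //=.
  by rewrite memS h1 h2 h3.
move=> [[[T1 T2] T3]] /=; rewrite memS => /and3P[h1 h2 h3] ->; split.
  by rewrite (glue_key _ _ _ _ _ _ tri h1 h2 h3).
by rewrite inE; exact: glue_composite.
Qed.

End Gluing.

Theorem proposition4p4 (n : nat) (mu nu la : intpart)
  (n_gt0 : (0 < n)%N)
  (mu_len : (size mu <= n)%N) (nu_len : (size nu <= n)%N)
  (la_len : (size la <= n)%N) :
  finite_set (composite_hives n mu nu la) /\
  nl_coef mu nu la = (#|` fset_set (composite_hives n mu nu la)|%fset)%:Z.
Proof.
split; first exact: finite_composite_hives.
by rewrite (nl_coefE mu_len nu_len la_len) card_composite_hives.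
Qed.
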